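(* Let $P$ be a convex pentagon with interior angles $A, B, C, D, E$ (in degrees) at its five corners. Suppose $P$ admits a periodic monohedral tiling of the plane, i.e. there is a tiling of the Euclidean plane by congruent copies of $P$ that is periodic. Then some three of the interior angles of $P$, chosen with repetition allowed, sum to $360^\circ$. That is, there exist $X, Y, Z \in \{A, B, C, D, E\}$, not necessarily distinct, with $X+Y+Z = 360^\circ$. Equivalently, at least one of the following 35 relations holds: - $\alpha+\beta+\gamma=360^\circ$ for three distinct angles $\alpha,\beta,\gamma\in\{A,B,C,D,E\}$; - $2\alpha+\beta=360^\circ$ for two distinct angles $\alpha,\beta\in\{A,B,C,D,E\}$; - $3\alpha=360^\circ$ for some $\alpha\in\{A,B,C,D,E\}$.
   Context: A tiling of the plane is a countable collection of closed sets (tiles) covering the plane such that distinct tiles have disjoint interiors. A tiling is monohedral if all tiles are congruent to a single shape; a convex pentagon admitting such a tiling is a convex pentagonal tile. Congruent copies may include reflected copies. The tiling is not required to be edge-to-edge. A tiling is periodic if it is mapped onto itself by translations in two nonparallel directions, i.e. it is invariant under translation by two linearly independent vectors. *)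

(* Defs.v *)
From Stdlib Require Import Reals Lra.
Open Scope R_scope.

Definition pt : Type := (R * R)%type.

Definition psub (a b : pt) : pt := (fst a - fst b, snd a - snd b).
Definition padd (a b : pt) : pt := (fst a + fst b, snd a + snd b).
Definition cross (a b : pt) : R := fst a * snd b - snd a * fst b.
Definition dot (a b : pt) : R := fst a * fst b + snd a * snd b.
Definition norm (a : pt) : R := sqrt (dot a a).
Definition dist (a b : pt) : R := norm (psub a b).

Definition nxt (i : nat) : nat := (S i) mod 5.
Definition prv (i : nat) : nat := (i + 4) mod 5.

(* V 0, ..., V 4 are the vertices (in cyclic order) of a convex pentagon:
   for every edge [V i, V (i+1)], the three remaining vertices lie strictly on
   the same side of the line through the edge, the side being the same for
   all edges (counterclockwise or clockwise listing). Strictness means no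
   three vertices are collinear, so all interior angles are < 180 degrees. *)
Definition convex_pentagon (V : nat -> pt) : Prop :=
  (forall i j, (i < 5)%nat -> (j < 5)%nat -> j <> i -> j <> nxt i ->
     0 < cross (psub (V (nxt i)) (V i)) (psub (V j) (V i))) \/
  (forall i j, (i < 5)%nat -> (j < 5)%nat -> j <> i -> j <> nxt i ->
     cross (psub (V (nxt i)) (V i)) (psub (V j) (V i)) < 0).

(* The closed pentagonal region: intersection of the closed half-planes
   bounded by the edge lines, on the side of the pentagon. *)
Definition pent_region (V : nat -> pt) (x : pt) : Prop :=
  forall i, (i < 5)%nat ->
    0 <= cross (psub (V (nxt i)) (V i)) (psub x (V i)) *
         cross (psub (V (nxt i)) (V i)) (psub (V (nxt (nxt i))) (V i)).

Definition interior_angle (V : nat -> pt) (i : nat) : R :=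
  let a := psub (V (prv i)) (V i) in
  let b := psub (V (nxt i)) (V i) in
  acos (dot a b / (norm a * norm b)) * 180 / PI.

Definition isometry (f : pt -> pt) : Prop :=
  forall x y, dist (f x) (f y) = dist x y.

Definition image (f : pt -> pt) (S : pt -> Prop) : pt -> Prop :=
  fun y => exists x, S x /\ y = f x.

Definition congruent (S T : pt -> Prop) : Prop :=
  exists f, isometry f /\ (forall y, T y <-> image f S y).

Definition interior (S : pt -> Prop) (x : pt) : Prop :=
  exists eps, 0 < eps /\ forall y, dist x y < eps -> S y.

Definition countable_coll (T : (pt -> Prop) -> Prop) : Prop :=
  exists g : nat -> (pt -> Prop), forall t, T t -> exists n, g n = t.

(* Tiling: countable collection of closed sets covering the plane with
   pairwise disjoint interiors (tiles here are congruent copies of a closed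
   polygon, hence closed). *)
Definition is_tiling (T : (pt -> Prop) -> Prop) : Prop :=
  countable_coll T /\
  (forall x, exists t, T t /\ t x) /\
  (forall t1 t2, T t1 -> T t2 -> t1 <> t2 ->
     forall x, ~ (interior t1 x /\ interior t2 x)).

Definition monohedral_tiling_by (S : pt -> Prop) (T : (pt -> Prop) -> Prop) : Prop :=
  is_tiling T /\ forall t, T t -> congruent S t.

Definition translate (w : pt) (t : pt -> Prop) : pt -> Prop :=
  fun y => t (psub y w).

Definition periodic (T : (pt -> Prop) -> Prop) : Prop :=
  exists u v : pt, cross u v <> 0 /\
    (forall t, T t <-> T (translate u t)) /\
    (forall t, T t <-> T (translate v t)).

(* Main.v *)
(* Suppose that no three angles of the pentagon sum to 2 pi.  Every point q at which some tile has
   a corner is either interior to an edge of one other tile, and then the corners at q fill the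
   remaining half-plane, so that there are at least two of them with sum pi; or all tiles at q
   have a corner there, and then the corner angles sum to 2 pi, so that there are at least three
   of them, hence at least four by assumption.  In both cases the sum of (angle - pi/2) over the
   corners at q is at most 0.  Summing over all corners modulo the lattice of periods contradicts
   the angle sum of the pentagon: every tile contributes 3 pi - 5 pi/2 > 0. *)

From Stdlib Require Import Reals ZArith Lra Lia List Classical ClassicalEpsilon.
From Stdlib Require Import FunctionalExtensionality PropExtensionality.
From Coquelicot Require Import Coquelicot.
Require Import Defs.
Open Scope R_scope.
Import ListNotations.

(** The constant pi/2 separates two averages: the mean angle of a pentagon is 3 pi/5, while under
    the assumption the corners meeting at a point have mean at most pi/2. No cyclic order of the
    tiles around a point is ever built: an angle is the measure of a set of directions, and angle
    sums come from integrating indicators. Three obstacles shape the rest. A tile is a set, and a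
    pentagon with a symmetry is presented by several isometries that label its corners differently,
    so angles must be attached to sets. Countably many tiles cover the plane, and one of them fills
    an initial piece of a given ray only because tiles contain discs of a fixed radius, which makes
    the tiling locally finite; the same packing argument leaves finitely many tiles modulo periods.
    Finally, different corners in one class modulo periods must become corners of different tiles
    when moved to a common point; this holds because a pentagon is not invariant under a nonzero
    translation. *)

Ltac planar := unfold psub, padd, cross, dot; simpl.

(** * Isometries of the plane *)

Lemma dot_self_nonneg (a : pt) : 0 <= dot a a.
Proof. unfold dot; nra. Qed.

Lemma norm_sqr (a : pt) : norm a * norm a = dot a a.
Proof. apply sqrt_sqrt, dot_self_nonneg. Qed.

Lemma norm_nonneg (a : pt) : 0 <= norm a.
Proof. apply sqrt_pos. Qed.

Lemma binet_cauchy (a b c d : pt) :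
  cross a b * cross c d = dot a c * dot b d - dot a d * dot b c.
Proof. planar; ring. Qed.

(** Polarization: a dot product of differences is a combination of four squared distances. As
    [isometry] speaks of distances only, all later invariance is derived from this. *)
Lemma isometry_dot (f : pt -> pt) : isometry f -> forall x y z w,
  dot (psub (f x) (f y)) (psub (f z) (f w)) = dot (psub x y) (psub z w).
Proof.
  intros hf.
  assert (D : forall x y, dot (psub (f x) (f y)) (psub (f x) (f y))
                          = dot (psub x y) (psub x y)).
  { intros x y; rewrite <- !norm_sqr.
    change (dist (f x) (f y) * dist (f x) (f y) = dist x y * dist x y).
    now rewrite hf. }
  assert (polar : forall a b c d : pt, dot (psub a b) (psub c d) =
    (dot (psub a d) (psub a d) + dot (psub b c) (psub b c)
     - dot (psub a c) (psub a c) - dot (psub b d) (psub b d)) / 2).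
  { intros; planar; field. }
  intros x y z w; rewrite (polar (f x)), !D, <- polar; reflexivity.
Qed.

Lemma isometry_norm (f : pt -> pt) : isometry f -> forall x y,
  norm (psub (f x) (f y)) = norm (psub x y).
Proof. intros hf x y; apply hf. Qed.

(** A reflection changes the sign of one cross product, but a product of two is a polynomial in dot
    products. The inequalities in [pent_region] are of this form. *)
Lemma isometry_cross_mul (f : pt -> pt) : isometry f -> forall x y z w x' y' z' w',
  cross (psub (f x) (f y)) (psub (f z) (f w)) *
  cross (psub (f x') (f y')) (psub (f z') (f w')) =
  cross (psub x y) (psub z w) * cross (psub x' y') (psub z' w').
Proof. intros hf; intros; rewrite !binet_cauchy, !isometry_dot by assumption; reflexivity. Qed.

(** The images of the two unit vectors form an orthonormal frame at [f (0, 0)]. The preimage of [y]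
    is the pair of its coordinates in this frame; the difference [n] is orthogonal to both frame
    vectors, hence zero. *)
Lemma isometry_surjective (f : pt -> pt) : isometry f -> forall y, exists x, f x = y.
Proof.
  intros hf y.
  set (o := f (0, 0)); set (a := psub (f (1, 0)) o); set (b := psub (f (0, 1)) o).
  set (z := psub y o); set (x := (dot z a, dot z b) : pt).
  assert (Haa : dot a a = 1).
  { unfold a, o; rewrite isometry_dot by assumption; planar; ring. }
  assert (Hbb : dot b b = 1).
  { unfold b, o; rewrite isometry_dot by assumption; planar; ring. }
  assert (Hab : dot a b = 0).
  { unfold a, b, o; rewrite isometry_dot by assumption; planar; ring. }
  assert (Ha : dot (psub (f x) o) a = dot z a).
  { transitivity (fst x); [|reflexivity].
    unfold a, o; rewrite isometry_dot by assumption; clearbody x; planar; ring. }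
  assert (Hb : dot (psub (f x) o) b = dot z b).
  { transitivity (snd x); [|reflexivity].
    unfold b, o; rewrite isometry_dot by assumption; clearbody x; planar; ring. }
  exists x.
  assert (Hc : cross a b * cross a b = 1) by (rewrite binet_cauchy; rewrite Haa, Hbb, Hab; unfold dot in *; nra).
  set (n := psub (f x) y).
  assert (Na : dot n a = 0) by (unfold n, z in *; revert Ha; planar; lra).
  assert (Nb : dot n b = 0) by (unfold n, z in *; revert Hb; planar; lra).
  assert (N1 : fst n * cross a b = 0).
  { replace (fst n * cross a b) with (dot n a * snd b - dot n b * snd a) by (planar; ring).
    rewrite Na, Nb; ring. }
  assert (N2 : snd n * cross a b = 0).
  { replace (snd n * cross a b) with (dot n b * fst a - dot n a * fst b) by (planar; ring).
    rewrite Na, Nb; ring. }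
  assert (fst n = 0) by nra.
  assert (snd n = 0) by nra.
  destruct (f x) as [p q], y as [r s]; unfold n in *; simpl in *.
  f_equal; lra.
Qed.

Lemma isometry_padd (f : pt -> pt) (w : pt) :
  isometry f -> isometry (fun x => padd (f x) w).
Proof.
  intros hf x y; rewrite <- (hf x y); unfold dist; f_equal.
  unfold psub, padd; simpl; f_equal; ring.
Qed.

Definition tile (V : nat -> pt) (f : pt -> pt) : pt -> Prop :=
  pent_region (fun i => f (V i)).

Lemma tile_isometry (V : nat -> pt) (f : pt -> pt) (x : pt) :
  isometry f -> (tile V f (f x) <-> pent_region V x).
Proof.
  intros hf; unfold tile, pent_region.
  split; intros H i hi; specialize (H i hi);
    rewrite isometry_cross_mul in * by assumption; assumption.
Qed.

Lemma pred_ext (S T : pt -> Prop) : (forall x, S x <-> T x) -> S = T.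
Proof. intros H; extensionality x; apply propositional_extensionality, H. Qed.

Lemma congruent_tile (V : nat -> pt) (t : pt -> Prop) :
  congruent (pent_region V) t -> exists f, isometry f /\ t = tile V f.
Proof.
  intros [f [hf H]]; exists f; split; [assumption|].
  apply pred_ext; intros y; rewrite H; split.
  - intros [x [Hx ->]]; now apply tile_isometry.
  - intros Hy; destruct (isometry_surjective f hf y) as [x <-].
    exists x; split; [|reflexivity]; now apply (tile_isometry V f x hf).
Qed.

Lemma translate_tile (V : nat -> pt) (f : pt -> pt) (w : pt) :
  translate w (tile V f) = tile V (fun x => padd (f x) w).
Proof.
  apply pred_ext; intros x; unfold translate, tile, pent_region.
  assert (E : forall i, cross (psub (f (V (nxt i))) (f (V i))) (psub (psub x w) (f (V i))) *
         cross (psub (f (V (nxt i))) (f (V i))) (psub (f (V (nxt (nxt i)))) (f (V i))) =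
    cross (psub (padd (f (V (nxt i))) w) (padd (f (V i)) w)) (psub x (padd (f (V i)) w)) *
         cross (psub (padd (f (V (nxt i))) w) (padd (f (V i)) w)) (psub (padd (f (V (nxt (nxt i)))) w) (padd (f (V i)) w))).
  { intros i; planar; ring. }
  split; intros H i hi; specialize (H i hi); [rewrite <- E | rewrite E]; assumption.
Qed.

(** All cross products of differences are multiplied by one common factor [s / s'], equal to 1 or
    -1, so the orientation is kept everywhere or reversed everywhere. *)
Lemma isometry_convex (V : nat -> pt) (f : pt -> pt) :
  isometry f -> convex_pentagon V -> convex_pentagon (fun i => f (V i)).
Proof.
  intros hf HV.
  set (s := cross (psub (V 1%nat) (V 0%nat)) (psub (V 2%nat) (V 0%nat))).
  set (s' := cross (psub (f (V 1%nat)) (f (V 0%nat))) (psub (f (V 2%nat)) (f (V 0%nat)))).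
  assert (Hs : s <> 0).
  { destruct HV as [H|H]; specialize (H 0%nat 2%nat ltac:(lia) ltac:(lia) ltac:(lia) ltac:(unfold nxt; simpl; lia));
    unfold nxt in H; simpl in H; unfold s; lra. }
  assert (Hss : s' * s' = s * s) by (unfold s, s'; now apply isometry_cross_mul).
  assert (K : forall i j, cross (psub (f (V (nxt i))) (f (V i))) (psub (f (V j)) (f (V i))) * s'
     = cross (psub (V (nxt i)) (V i)) (psub (V j) (V i)) * s).
  { intros i j; unfold s, s'; now apply isometry_cross_mul. }
  assert (Hd : s' = s \/ s' = - s).
  { assert (E : (s' - s) * (s' + s) = 0) by (ring_simplify; lra).
    apply Rmult_integral in E; destruct E; [left|right]; lra. }
  assert (K' : forall i j, cross (psub (f (V (nxt i))) (f (V i))) (psub (f (V j)) (f (V i)))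
     = cross (psub (V (nxt i)) (V i)) (psub (V j) (V i)) * (s / s')).
  { intros i j; specialize (K i j).
    assert (s' <> 0) by (destruct Hd; lra).
    apply (Rmult_eq_reg_r s'); [rewrite K; field; assumption | assumption]. }
  assert (Hr : s / s' = 1 \/ s / s' = -1).
  { destruct Hd as [-> | ->]; [left|right]; field; lra. }
  unfold convex_pentagon.
  destruct HV as [H|H], Hr as [r|r]; rewrite r in K';
    [left|right|right|left]; intros i j h1 h2 h3 h4; rewrite K';
    specialize (H i j h1 h2 h3 h4); lra.
Qed.

(** * Angles *)

Definition vec_angle (a b : pt) : R := acos (dot a b / (norm a * norm b)).

Lemma vec_angle_sym (a b : pt) : vec_angle a b = vec_angle b a.
Proof. unfold vec_angle; f_equal; f_equal; [unfold dot|]; ring. Qed.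

Lemma cross_pos_norm (a b : pt) : 0 < cross a b -> 0 < norm a /\ 0 < norm b.
Proof.
  intros H; pose proof (norm_nonneg a); pose proof (norm_nonneg b).
  pose proof (norm_sqr a) as Ha; pose proof (norm_sqr b) as Hb.
  pose proof (binet_cauchy a b a b) as E.
  rewrite <- Ha, <- Hb in E.
  assert (0 < cross a b * cross a b) by nra.
  assert (0 <= dot a b * dot a b) by nra.
  assert (dot b a = dot a b) by (unfold dot; ring).
  split.
  - destruct (Req_dec (norm a) 0) as [e|]; [rewrite e in E; nra | lra].
  - destruct (Req_dec (norm b) 0) as [e|]; [rewrite e in E; nra | lra].
Qed.

Lemma vec_angle_spec (a b : pt) : 0 < cross a b ->
  0 < vec_angle a b < PI /\
  cos (vec_angle a b) * (norm a * norm b) = dot a b /\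
  sin (vec_angle a b) * (norm a * norm b) = cross a b.
Proof.
  intros H; destruct (cross_pos_norm a b H) as [Ha Hb].
  set (k := norm a * norm b).
  assert (Hk : 0 < k) by (unfold k; nra).
  assert (E : dot a b * dot a b + cross a b * cross a b = k * k).
  { rewrite binet_cauchy.
    replace (k * k) with ((norm a * norm a) * (norm b * norm b)) by (unfold k; ring).
    rewrite !norm_sqr; replace (dot b a) with (dot a b) by (unfold dot; ring); ring. }
  assert (F : (dot a b / k) * (dot a b / k) + (cross a b / k) * (cross a b / k) = 1).
  { transitivity ((dot a b * dot a b + cross a b * cross a b) / (k * k)); [field; lra|].
    rewrite E; field; lra. }
  assert (Hc : 0 < cross a b / k) by (apply Rdiv_lt_0_compat; assumption).
  assert (B : -1 < dot a b / k < 1) by nra.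
  unfold vec_angle; fold k; split; [apply acos_bound_lt, B|split].
  - rewrite cos_acos by lra; field; lra.
  - rewrite sin_acos by lra.
    replace (1 - Rsqr (dot a b / k)) with (Rsqr (cross a b / k)) by (unfold Rsqr; lra).
    rewrite sqrt_Rsqr by lra; field; lra.
Qed.

(** Additivity of angles is proved by comparing cosine and sine; the strict bound excludes a
    difference by a nonzero multiple of 2 pi. *)
Lemma angle_eq (x y : R) :
  cos x = cos y -> sin x = sin y -> - (2 * PI) < x - y < 2 * PI -> x = y.
Proof.
  intros Hc Hs Hb.
  assert (E : cos (x - y) = 1).
  { rewrite cos_minus, Hc, Hs; pose proof (sin2_cos2 y); unfold Rsqr in *; lra. }
  assert (S : sin ((x - y) / 2) = 0).
  { replace (x - y) with (2 * ((x - y) / 2)) in E by field.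
    rewrite cos_2a_sin in E; nra. }
  destruct (Rtotal_order (x - y) 0) as [h|[h|h]]; [|lra|].
  - assert (0 < sin (- ((x - y) / 2))) by (apply sin_gt_0; lra).
    rewrite sin_neg in *; lra.
  - assert (0 < sin ((x - y) / 2)) by (apply sin_gt_0; lra); lra.
Qed.

Lemma vec_angle_add (a b c : pt) :
  0 < cross a b -> 0 < cross b c -> 0 < cross a c -> vec_angle a c = vec_angle a b + vec_angle b c.
Proof.
  intros Hab Hbc Hac.
  destruct (cross_pos_norm a b Hab) as [Na Nb].
  destruct (cross_pos_norm b c Hbc) as [_ Nc].
  destruct (vec_angle_spec a b Hab) as [B1 [C1 S1]].
  destruct (vec_angle_spec b c Hbc) as [B2 [C2 S2]].
  destruct (vec_angle_spec a c Hac) as [B3 [C3 S3]].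
  set (A := norm a) in *; set (B := norm b) in *; set (C := norm c) in *.
  assert (HB : B * B = dot b b) by apply norm_sqr.
  (* In the addition formulas [b] occurs in both factors, so this multiplier clears all norms and
     leaves polynomial identities in the coordinates. *)
  assert (Hk : 0 < A * C * (B * B)) by (repeat apply Rmult_lt_0_compat; assumption).
  apply angle_eq; [| |lra]; apply (Rmult_eq_reg_r (A * C * (B * B))); try lra.
  - rewrite cos_plus.
    transitivity ((cos (vec_angle a c) * (A * C)) * (B * B)); [ring|].
    transitivity ((cos (vec_angle a b) * (A * B)) * (cos (vec_angle b c) * (B * C)) -
      (sin (vec_angle a b) * (A * B)) * (sin (vec_angle b c) * (B * C))); [|ring].
    rewrite C1, C2, C3, S1, S2, HB; planar; ring.
  - rewrite sin_plus.
    transitivity ((sin (vec_angle a c) * (A * C)) * (B * B)); [ring|].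
    transitivity ((sin (vec_angle a b) * (A * B)) * (cos (vec_angle b c) * (B * C)) +
      (cos (vec_angle a b) * (A * B)) * (sin (vec_angle b c) * (B * C))); [|ring].
    rewrite C1, C2, S3, S1, S2, HB; planar; ring.
Qed.

Lemma norm_psub_sym (p q : pt) : norm (psub p q) = norm (psub q p).
Proof. unfold norm; f_equal; planar; ring. Qed.

Lemma triangle_sum (p q r : pt) : 0 < cross (psub q p) (psub r p) ->
  vec_angle (psub q p) (psub r p) + vec_angle (psub r q) (psub p q) + vec_angle (psub p r) (psub q r) = PI.
Proof.
  intros H.
  assert (H2 : 0 < cross (psub r q) (psub p q)) by (revert H; planar; lra).
  assert (H3 : 0 < cross (psub p r) (psub q r)) by (revert H; planar; lra).
  destruct (cross_pos_norm _ _ H) as [Na Nb].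
  destruct (cross_pos_norm _ _ H2) as [Nc _].
  destruct (vec_angle_spec _ _ H) as [B1 [C1 S1]].
  destruct (vec_angle_spec _ _ H2) as [B2 [C2 S2]].
  destruct (vec_angle_spec _ _ H3) as [B3 [C3 S3]].
  rewrite (norm_psub_sym p q) in *; rewrite (norm_psub_sym p r) in *;
    rewrite (norm_psub_sym q r) in *.
  set (x := vec_angle (psub q p) _) in *; set (y := vec_angle (psub r q) _) in *;
    set (z := vec_angle (psub p r) _) in *.
  pose proof (norm_sqr (psub q p)) as HA; pose proof (norm_sqr (psub r p)) as HB;
    pose proof (norm_sqr (psub r q)) as HC.
  set (A := norm (psub q p)) in *; set (B := norm (psub r p)) in *;
    set (C := norm (psub r q)) in *.
  (* Each side of the triangle is adjacent to two of its angles, so its length enters twice. *)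
  assert (Hk : 0 < (A * A) * (B * B) * (C * C))
    by (repeat apply Rmult_lt_0_compat; assumption).
  apply angle_eq; [rewrite cos_PI|rewrite sin_PI|lra];
    apply (Rmult_eq_reg_r ((A * A) * (B * B) * (C * C))); try lra.
  - rewrite cos_plus, cos_plus, sin_plus.
    transitivity (((cos x * (A * B)) * (cos y * (C * A)) - (sin x * (A * B)) * (sin y * (C * A)))
      * (cos z * (B * C)) - ((sin x * (A * B)) * (cos y * (C * A)) + (cos x * (A * B)) * (sin y * (C * A)))
      * (sin z * (B * C))); [ring|].
    rewrite C1, C2, C3, S1, S2, S3, HA, HB, HC; planar; ring.
  - rewrite sin_plus, cos_plus, sin_plus.
    transitivity (((cos x * (A * B)) * (cos y * (C * A)) - (sin x * (A * B)) * (sin y * (C * A)))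
      * (sin z * (B * C)) + ((sin x * (A * B)) * (cos y * (C * A)) + (cos x * (A * B)) * (sin y * (C * A)))
      * (cos z * (B * C))); [ring|].
    rewrite C1, C2, C3, S1, S2, S3, HA, HB, HC; planar; ring.
Qed.

Definition det (p q r : pt) : R := cross (psub q p) (psub r p).

(** Fan triangulation from [p0]: the three triangles contribute pi each, and the angles at [p0],
    [p2] and [p3] are split by the diagonals through [p0]. *)
Lemma pentagon_sum_ccw (p0 p1 p2 p3 p4 : pt) :
  0 < det p0 p1 p2 -> 0 < det p0 p2 p3 -> 0 < det p0 p3 p4 ->
  0 < det p0 p1 p3 -> 0 < det p0 p1 p4 ->
  0 < det p1 p2 p3 -> 0 < det p2 p3 p4 ->
  vec_angle (psub p4 p0) (psub p1 p0) + vec_angle (psub p0 p1) (psub p2 p1) +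
  vec_angle (psub p1 p2) (psub p3 p2) + vec_angle (psub p2 p3) (psub p4 p3) +
  vec_angle (psub p3 p4) (psub p0 p4) = 3 * PI.
Proof.
  intros H012 H023 H034 H013 H014 H123 H234.
  pose proof (triangle_sum p0 p1 p2 H012) as T1.
  pose proof (triangle_sum p0 p2 p3 H023) as T2.
  pose proof (triangle_sum p0 p3 p4 H034) as T3.
  assert (A1 : vec_angle (psub p1 p0) (psub p3 p0) = vec_angle (psub p1 p0) (psub p2 p0) + vec_angle (psub p2 p0) (psub p3 p0))
    by (apply vec_angle_add; assumption).
  assert (A2 : vec_angle (psub p1 p0) (psub p4 p0) = vec_angle (psub p1 p0) (psub p3 p0) + vec_angle (psub p3 p0) (psub p4 p0))
    by (apply vec_angle_add; assumption).
  assert (A3 : vec_angle (psub p3 p2) (psub p1 p2) = vec_angle (psub p3 p2) (psub p0 p2) + vec_angle (psub p0 p2) (psub p1 p2)).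
  { apply vec_angle_add; revert H012 H023 H123; unfold det; planar; lra. }
  assert (A4 : vec_angle (psub p4 p3) (psub p2 p3) = vec_angle (psub p4 p3) (psub p0 p3) + vec_angle (psub p0 p3) (psub p2 p3)).
  { apply vec_angle_add; revert H034 H023 H234; unfold det; planar; lra. }
  rewrite (vec_angle_sym (psub p4 p0) (psub p1 p0)), (vec_angle_sym (psub p0 p1) (psub p2 p1)),
    (vec_angle_sym (psub p1 p2) (psub p3 p2)), (vec_angle_sym (psub p2 p3) (psub p4 p3)),
    (vec_angle_sym (psub p3 p4) (psub p0 p4)).
  lra.
Qed.

Definition corner_angle (V : nat -> pt) (i : nat) : R :=
  vec_angle (psub (V (prv i)) (V i)) (psub (V (nxt i)) (V i)).

Lemma pentagon_sum (V : nat -> pt) : convex_pentagon V ->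
  corner_angle V 0 + corner_angle V 1 + corner_angle V 2 + corner_angle V 3 + corner_angle V 4 = 3 * PI.
Proof.
  intros [H|H];
  assert (H01 := H 0%nat); assert (H1 := H 1%nat); assert (H2 := H 2%nat);
    assert (H3 := H 3%nat); assert (H4 := H 4%nat);
  unfold nxt in *; simpl in *;
  pose proof (H01 2%nat ltac:(lia) ltac:(lia) ltac:(lia) ltac:(lia)) as D012;
  pose proof (H01 3%nat ltac:(lia) ltac:(lia) ltac:(lia) ltac:(lia)) as D013;
  pose proof (H01 4%nat ltac:(lia) ltac:(lia) ltac:(lia) ltac:(lia)) as D014;
  pose proof (H1 3%nat ltac:(lia) ltac:(lia) ltac:(lia) ltac:(lia)) as D123;
  pose proof (H1 4%nat ltac:(lia) ltac:(lia) ltac:(lia) ltac:(lia)) as D124;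
  pose proof (H2 0%nat ltac:(lia) ltac:(lia) ltac:(lia) ltac:(lia)) as D230;
  pose proof (H2 4%nat ltac:(lia) ltac:(lia) ltac:(lia) ltac:(lia)) as D234;
  pose proof (H3 0%nat ltac:(lia) ltac:(lia) ltac:(lia) ltac:(lia)) as D340;
  pose proof (H4 2%nat ltac:(lia) ltac:(lia) ltac:(lia) ltac:(lia)) as D402;
  clear H H01 H1 H2 H3 H4; unfold corner_angle, prv, nxt; simpl.
  - apply pentagon_sum_ccw; unfold det;
    revert D012 D013 D014 D123 D124 D230 D234 D340; planar; lra.
  (* A clockwise pentagon is counterclockwise when listed backwards. *)
  - rewrite <- (pentagon_sum_ccw (V 0%nat) (V 4%nat) (V 3%nat) (V 2%nat) (V 1%nat));
    try (unfold det; revert D012 D013 D014 D123 D124 D230 D234 D340 D402; planar; lra).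
    rewrite (vec_angle_sym (psub (V 4%nat) (V 0%nat))), (vec_angle_sym (psub (V 0%nat) (V 1%nat))),
      (vec_angle_sym (psub (V 1%nat) (V 2%nat))), (vec_angle_sym (psub (V 2%nat) (V 3%nat))),
      (vec_angle_sym (psub (V 3%nat) (V 4%nat))); ring.
Qed.

Lemma isometry_corner_angle (V : nat -> pt) (f : pt -> pt) (i : nat) :
  isometry f -> corner_angle (fun j => f (V j)) i = corner_angle V i.
Proof.
  intros hf; unfold corner_angle, vec_angle; rewrite isometry_dot, !isometry_norm by assumption; reflexivity.
Qed.

(** * Angles of a planar set at a point *)

Definition dir (t : R) : pt := (cos t, sin t).

Definition pmove (q : pt) (e : R) (d : pt) : pt := (fst q + e * fst d, snd q + e * snd d).

(** A short initial piece of the ray from [q] lies in [S]. The value [e = 0] is left out so that the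
    notion also makes sense for [interior S] when [q] is a boundary point. *)
Definition tangent (S : pt -> Prop) (q d : pt) : Prop :=
  exists e0, 0 < e0 /\ forall e, 0 < e < e0 -> S (pmove q e d).

Definition indic (P : Prop) : R := if excluded_middle_informative P then 1 else 0.

(* As an integral over directions, this angle depends on the set only, not on how the set is
   presented as a pentagon.  Interiors of tiles are disjoint and tiles cover, so the second
   integral bounds angle sums from above and the first one from below. *)
Definition has_angle (S : pt -> Prop) (q : pt) (m : R) : Prop :=
  is_RInt (fun t => indic (tangent S q (dir t))) 0 (2 * PI) m /\
  is_RInt (fun t => indic (tangent (interior S) q (dir t))) 0 (2 * PI) m.

Lemma indic_true (P : Prop) : P -> indic P = 1.
Proof. intros H; unfold indic; destruct excluded_middle_informative; tauto. Qed.

Lemma indic_false (P : Prop) : ~ P -> indic P = 0.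
Proof. intros H; unfold indic; destruct excluded_middle_informative; tauto. Qed.

Lemma indic_nonneg (P : Prop) : 0 <= indic P.
Proof. unfold indic; destruct excluded_middle_informative; lra. Qed.

Lemma is_RInt_indic_true (P : R -> Prop) (a b : R) : a <= b ->
  (forall t, a < t < b -> P t) -> is_RInt (fun t => indic (P t)) a b (b - a).
Proof.
  intros hab H; replace (b - a) with (scal (b - a) 1)
    by (unfold scal; simpl; unfold mult; simpl; ring).
  apply is_RInt_ext with (2 := is_RInt_const a b 1).
  intros t; rewrite Rmin_left, Rmax_right by assumption; intros ht.
  symmetry; apply indic_true, H, ht.
Qed.

Lemma is_RInt_indic_false (P : R -> Prop) (a b : R) : a <= b ->
  (forall t, a < t < b -> ~ P t) -> is_RInt (fun t => indic (P t)) a b 0.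
Proof.
  intros hab H; replace 0 with (scal (b - a) 0)
    by (unfold scal; simpl; unfold mult; simpl; ring).
  apply is_RInt_ext with (2 := is_RInt_const a b 0).
  intros t; rewrite Rmin_left, Rmax_right by assumption; intros ht.
  symmetry; apply indic_false, H, ht.
Qed.

Lemma is_RInt_chasles3 (f : R -> R) (a b c d x y z : R) :
  is_RInt f a b x -> is_RInt f b c y -> is_RInt f c d z -> is_RInt f a d (x + y + z).
Proof.
  intros H1 H2 H3.
  exact (is_RInt_Chasles f a c d (x + y) z (is_RInt_Chasles f a b c x y H1 H2) H3).
Qed.

Lemma periodic_Z (P : R -> Prop) : (forall t, P (t + 2 * PI) <-> P t) ->
  forall k t, P (t + IZR k * (2 * PI)) <-> P t.
Proof.
  intros HP.
  assert (N : forall n t, P (t + INR n * (2 * PI)) <-> P t).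
  { induction n as [|n IH]; intros t.
    - simpl; replace (t + 0 * (2 * PI)) with t by ring; tauto.
    - rewrite S_INR.
      replace (t + (INR n + 1) * (2 * PI)) with (t + INR n * (2 * PI) + 2 * PI) by ring.
      rewrite HP; apply IH. }
  intros k t; destruct (Z_le_gt_dec 0 k) as [hk|hk].
  - rewrite <- (Z2Nat.id k), <- INR_IZR_INZ by lia; apply N.
  - rewrite <- (N (Z.to_nat (- k)) (t + IZR k * (2 * PI))).
    rewrite INR_IZR_INZ, Z2Nat.id, opp_IZR by lia.
    replace (t + IZR k * (2 * PI) + - IZR k * (2 * PI)) with t by ring; tauto.
Qed.

(** Reduce [a] modulo 2 pi to [b] in [0, 2 pi); the arc from [b] to [b + g] either stays in the
    interval of integration or wraps around once. Nothing is assumed at the ends of the arc, where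
    the integral does not see [P]. *)
Lemma is_RInt_arc (P : R -> Prop) (a g : R) :
  (forall t, P (t + 2 * PI) <-> P t) -> 0 <= g <= 2 * PI ->
  (forall t, a < t < a + g -> P t) ->
  (forall t, a + g < t < a + 2 * PI -> ~ P t) ->
  is_RInt (fun t => indic (P t)) 0 (2 * PI) g.
Proof.
  intros HP Hg Hin Hout; pose proof PI_RGT_0 as Hpi.
  assert (HZ := periodic_Z P HP).
  destruct (base_Int_part (a / (2 * PI))) as [K1 K2].
  set (k := Int_part (a / (2 * PI))) in *.
  set (b := a - IZR k * (2 * PI)).
  assert (Ea : a = a / (2 * PI) * (2 * PI)) by (field; lra).
  assert (Hb : 0 <= b < 2 * PI).
  { unfold b; rewrite Ea at 1 2; nra. }
  assert (Hin' : forall t, b < t < b + g -> P t).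
  { intros t ht; rewrite <- (HZ k); apply Hin; unfold b in ht; lra. }
  assert (Hout' : forall t, b + g < t < b + 2 * PI -> ~ P t).
  { intros t ht; rewrite <- (HZ k); apply Hout; unfold b in ht; lra. }
  destruct (Rle_dec (b + g) (2 * PI)) as [h|h].
  - replace g with (0 + (b + g - b) + 0) by ring.
    apply is_RInt_chasles3 with b (b + g).
    + apply is_RInt_indic_false; [lra|]; intros t ht; rewrite <- HP; apply Hout'; lra.
    + apply is_RInt_indic_true; [lra|assumption].
    + apply is_RInt_indic_false; [lra|]; intros t ht; apply Hout'; lra.
  - replace g with (((b + g - 2 * PI) - 0) + 0 + (2 * PI - b)) by ring.
    apply is_RInt_chasles3 with (b + g - 2 * PI) b.
    + apply is_RInt_indic_true; [lra|]; intros t ht; rewrite <- HP; apply Hin'; lra.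
    + apply is_RInt_indic_false; [lra|]; intros t ht; rewrite <- HP; apply Hout'; lra.
    + apply is_RInt_indic_true; [lra|]; intros t ht; apply Hin'; lra.
Qed.

Lemma dist_self (x : pt) : dist x x = 0.
Proof.
  unfold dist, norm; replace (dot (psub x x) (psub x x)) with 0 by (planar; ring).
  apply sqrt_0.
Qed.

Lemma interior_incl (S : pt -> Prop) (x : pt) : interior S x -> S x.
Proof. intros [e [he H]]; apply H; rewrite dist_self; assumption. Qed.

Lemma tangent_incl (S T : pt -> Prop) (q d : pt) :
  (forall x, S x -> T x) -> tangent S q d -> tangent T q d.
Proof. intros H [e [he K]]; exists e; split; auto. Qed.

Lemma dir_period (t : R) : dir (t + 2 * PI) = dir t.
Proof.
  unfold dir; f_equal; [rewrite cos_plus | rewrite sin_plus];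
    rewrite cos_2PI, sin_2PI; ring.
Qed.

(** Inside the arc the stronger predicate holds and outside it the weaker one fails, so [S] and its
    interior give the same integral. *)
Lemma has_angle_arc (S : pt -> Prop) (q : pt) (a g : R) :
  0 <= g <= 2 * PI ->
  (forall t, a < t < a + g -> tangent (interior S) q (dir t)) ->
  (forall t, a + g < t < a + 2 * PI -> ~ tangent S q (dir t)) ->
  has_angle S q g.
Proof.
  intros Hg Hin Hout.
  split; apply is_RInt_arc with a; try assumption; try (intros t; rewrite dir_period; tauto).
  - intros t ht; apply (tangent_incl (interior S)); [apply interior_incl | auto].
  - intros t ht K; apply (Hout t ht).
    now apply (tangent_incl (interior S)); [apply interior_incl |].
Qed.

Lemma polar (a : pt) : 0 < norm a -> exists t, a = (norm a * cos t, norm a * sin t).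
Proof.
  intros H; pose proof (norm_sqr a) as E.
  set (r := norm a) in *; set (x := fst a / r); set (y := snd a / r).
  assert (F : x * x + y * y = 1).
  { unfold x, y; transitivity (dot a a / (r * r)); [unfold dot; field; lra|].
    rewrite <- E; field; lra. }
  assert (B : -1 <= x <= 1) by nra.
  assert (Ex : fst a = r * x) by (unfold x; field; lra).
  assert (Ey : snd a = r * y) by (unfold y; field; lra).
  assert (Ea : a = (r * x, r * y)) by (rewrite <- Ex, <- Ey; apply surjective_pairing).
  assert (S : sin (acos x) = Rabs y).
  { rewrite sin_acos by assumption.
    replace (1 - Rsqr x) with (Rsqr y) by (unfold Rsqr; lra); apply sqrt_Rsqr_abs. }
  destruct (Rle_dec 0 y) as [h|h].
  - exists (acos x); rewrite cos_acos, S, Rabs_right by lra; assumption.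
  - exists (- acos x); rewrite cos_neg, sin_neg, cos_acos, S, Rabs_left by lra.
    rewrite Ropp_involutive; assumption.
Qed.

Lemma sin_neg_PI_2PI (x : R) : PI < x < 2 * PI -> sin x < 0.
Proof. intros; apply sin_lt_0; lra. Qed.

(** Here [a] directs the boundary line, with [S] on its left near [q]. *)
Lemma has_angle_halfplane (S : pt -> Prop) (q a : pt) : 0 < norm a ->
  (forall d, 0 < cross a d -> tangent (interior S) q d) ->
  (forall d, cross a d < 0 -> ~ tangent S q d) ->
  has_angle S q PI.
Proof.
  intros Ha Hin Hout; pose proof PI_RGT_0.
  destruct (polar a Ha) as [t0 E].
  assert (C : forall t, cross a (dir t) = norm a * sin (t - t0)).
  { intros t; rewrite E at 1; unfold cross, dir; simpl; rewrite sin_minus; ring. }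
  apply has_angle_arc with t0; [lra| |].
  - intros t ht; apply Hin; rewrite C; apply Rmult_lt_0_compat; [assumption|].
    apply sin_gt_0; lra.
  - intros t ht; apply Hout; rewrite C.
    assert (sin (t - t0) < 0) by (apply sin_neg_PI_2PI; lra); nra.
Qed.

Lemma has_angle_cone (S : pt -> Prop) (q a b : pt) : 0 < cross a b ->
  (forall d, 0 < cross a d -> 0 < cross d b -> tangent (interior S) q d) ->
  (forall d, cross a d < 0 \/ cross d b < 0 -> ~ tangent S q d) ->
  has_angle S q (vec_angle a b).
Proof.
  intros Hab Hin Hout; pose proof PI_RGT_0.
  destruct (cross_pos_norm a b Hab) as [Ha Hb].
  destruct (vec_angle_spec a b Hab) as [Bg [Cg Sg]]; set (g := vec_angle a b) in *.
  destruct (polar a Ha) as [t0 E].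
  assert (C : forall t, cross a (dir t) = norm a * sin (t - t0)).
  { intros t; rewrite E at 1; unfold cross, dir; simpl; rewrite sin_minus; ring. }
  (* Up to length, [b] is [a] turned by [g]; this is encoded in [Cg] and [Sg]. Multiplying by the
     square of [norm a] expresses [b] through [a], whose polar form is known. *)
  assert (D : forall t, cross (dir t) b = norm b * sin (t0 + g - t)).
  { intros t; apply (Rmult_eq_reg_r (norm a * norm a)); [|nra].
    transitivity (norm a * cos t0 * (cos t * (sin g * (norm a * norm b)) - sin t * (cos g * (norm a * norm b)))
      + norm a * sin t0 * (cos t * (cos g * (norm a * norm b)) + sin t * (sin g * (norm a * norm b)))).
    - rewrite Cg, Sg, norm_sqr.
      replace (norm a * cos t0) with (fst a) by (rewrite E at 1; reflexivity).
      replace (norm a * sin t0) with (snd a) by (rewrite E at 1; reflexivity).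
      unfold cross, dot, dir; simpl; ring.
    - rewrite sin_minus, sin_plus, cos_plus; ring. }
  apply has_angle_arc with t0; [lra| |].
  - intros t ht; apply Hin; [rewrite C | rewrite D]; (apply Rmult_lt_0_compat; [assumption|]);
      apply sin_gt_0; lra.
  - intros t ht; apply Hout; rewrite C, D.
    destruct (Rle_dec (t - t0) PI) as [h|h].
    + right; assert (0 < sin (- (t0 + g - t))) by (apply sin_gt_0; lra).
      rewrite sin_neg in *; nra.
    + left; assert (sin (t - t0) < 0) by (apply sin_neg_PI_2PI; lra); nra.
Qed.

(** * Pentagonal regions near a point *)

(** The affine function of [x] whose nonnegativity is the [j]-th condition of [pent_region]. The
    second factor is independent of [x] and fixes the sign for either orientation; [edge_slope] is
    the linear part. *)
Definition edge_form (W : nat -> pt) (j : nat) (x : pt) : R :=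
  cross (psub (W (nxt j)) (W j)) (psub x (W j)) *
  cross (psub (W (nxt j)) (W j)) (psub (W (nxt (nxt j))) (W j)).

Definition edge_slope (W : nat -> pt) (j : nat) (d : pt) : R :=
  cross (psub (W (nxt j)) (W j)) d *
  cross (psub (W (nxt j)) (W j)) (psub (W (nxt (nxt j))) (W j)).

Lemma edge_form_pmove (W : nat -> pt) (j : nat) (q d : pt) (e : R) :
  edge_form W j (pmove q e d) = edge_form W j q + e * edge_slope W j d.
Proof. unfold edge_form, edge_slope, pmove; planar; ring. Qed.

Lemma list_eps {A : Type} (P : A -> R -> Prop) (l : list A) :
  (forall a, In a l -> exists e0, 0 < e0 /\ forall e, 0 < e < e0 -> P a e) ->
  exists e0, 0 < e0 /\ forall e, 0 < e < e0 -> forall a, In a l -> P a e.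
Proof.
  induction l as [|x l IH]; intros H.
  - exists 1; split; [lra|simpl; tauto].
  - destruct IH as [e1 [h1 K1]]; [intros a ha; apply H; now right|].
    destruct (H x (or_introl eq_refl)) as [e2 [h2 K2]].
    exists (Rmin e1 e2); split; [apply Rmin_pos; assumption|].
    intros e he a ha; pose proof (Rmin_l e1 e2); pose proof (Rmin_r e1 e2).
    destruct ha as [<-|ha]; [apply K2; lra | apply K1; [lra|assumption]].
Qed.

Lemma finite_eps (n : nat) (P : nat -> R -> Prop) :
  (forall j, (j < n)%nat -> exists e0, 0 < e0 /\ forall e, 0 < e < e0 -> P j e) ->
  exists e0, 0 < e0 /\ forall e, 0 < e < e0 -> forall j, (j < n)%nat -> P j e.
Proof.
  intros H; destruct (list_eps P (seq 0 n)) as [e0 [h0 K]].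
  - intros j hj; apply H; apply in_seq in hj; lia.
  - exists e0; split; [assumption|]; intros e he j hj; apply K; [assumption|].
    apply in_seq; lia.
Qed.

Lemma abs_le_norm (d : pt) : Rabs (fst d) <= norm d /\ Rabs (snd d) <= norm d.
Proof.
  pose proof (norm_sqr d) as E; pose proof (norm_nonneg d); unfold dot in E.
  split; apply Rabs_le; split; nra.
Qed.

Lemma interior_region (W : nat -> pt) (x : pt) :
  (forall j, (j < 5)%nat -> 0 < edge_form W j x) -> interior (pent_region W) x.
Proof.
  intros H.
  destruct (finite_eps 5 (fun j e => forall y, dist x y < e -> 0 <= edge_form W j y)) as [e0 [h0 K]].
  - intros j hj; specialize (H j hj).
    set (E := psub (W (nxt j)) (W j)).
    set (k := cross E (psub (W (nxt (nxt j))) (W j))).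
    set (C := (Rabs (fst E) + Rabs (snd E)) * Rabs k).
    assert (HC : 0 <= C).
    { unfold C; apply Rmult_le_pos; [|apply Rabs_pos].
      pose proof (Rabs_pos (fst E)); pose proof (Rabs_pos (snd E)); lra. }
    (* [C] is a Lipschitz constant of the edge form; adding 1 keeps the denominator positive. *)
    exists (edge_form W j x / (C + 1)); split; [apply Rdiv_lt_0_compat; lra|].
    intros e he y hy.
    assert (EG : edge_form W j y = edge_form W j x - edge_slope W j (psub x y)) by (unfold edge_form, edge_slope; planar; ring).
    destruct (abs_le_norm (psub x y)) as [A1 A2]; fold (dist x y) in A1, A2.
    assert (B : Rabs (edge_slope W j (psub x y)) <= C * dist x y).
    { unfold edge_slope; fold E; fold k; rewrite Rabs_mult; unfold C.
      replace ((Rabs (fst E) + Rabs (snd E)) * Rabs k * dist x y) with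
        ((Rabs (fst E) + Rabs (snd E)) * dist x y * Rabs k) by ring.
      apply Rmult_le_compat_r; [apply Rabs_pos|].
      unfold cross, Rminus.
      eapply Rle_trans; [apply Rabs_triang|]; rewrite Rabs_Ropp, !Rabs_mult.
      pose proof (Rabs_pos (fst E)); pose proof (Rabs_pos (snd E)); nra. }
    assert (M : (C + 1) * dist x y < edge_form W j x).
    { assert (dist x y < edge_form W j x / (C + 1)) by lra.
      replace (edge_form W j x) with ((C + 1) * (edge_form W j x / (C + 1))) by (field; lra).
      apply Rmult_lt_compat_l; lra. }
    pose proof (Rle_abs (edge_slope W j (psub x y))).
    assert (0 <= dist x y) by apply norm_nonneg.
    lra.
  - exists (e0 / 2); split; [lra|].
    intros y hy j hj; apply (K (e0 / 2)); [lra|assumption|assumption].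
Qed.

(** A constraint that is strict at [q] survives a short move in any direction; an active one must
    increase along [d]. *)
Lemma tangent_interior_region (W : nat -> pt) (q d : pt) :
  (forall j, (j < 5)%nat -> 0 < edge_form W j q \/ edge_form W j q = 0 /\ 0 < edge_slope W j d) ->
  tangent (interior (pent_region W)) q d.
Proof.
  intros H.
  destruct (finite_eps 5 (fun j e => 0 < edge_form W j (pmove q e d))) as [e0 [h0 K]].
  - intros j hj; destruct (H j hj) as [h|[h h']].
    + exists (edge_form W j q / (Rabs (edge_slope W j d) + 1)).
      pose proof (Rabs_pos (edge_slope W j d)).
      split; [apply Rdiv_lt_0_compat; lra|].
      intros e he; rewrite edge_form_pmove.
      assert (e * (Rabs (edge_slope W j d) + 1) < edge_form W j q).
      { replace (edge_form W j q) with (edge_form W j q / (Rabs (edge_slope W j d) + 1) * (Rabs (edge_slope W j d) + 1)) by (field; lra).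
        apply Rmult_lt_compat_r; lra. }
      pose proof (Rle_abs (- edge_slope W j d)); rewrite Rabs_Ropp in *; nra.
    + exists 1; split; [lra|]; intros e he; rewrite edge_form_pmove, h; nra.
  - exists e0; split; [assumption|]; intros e he; apply interior_region; auto.
Qed.

Lemma not_tangent_region (W : nat -> pt) (q d : pt) (j : nat) :
  (j < 5)%nat -> edge_form W j q = 0 -> edge_slope W j d < 0 -> ~ tangent (pent_region W) q d.
Proof.
  intros hj h h' [e0 [h0 K]].
  specialize (K (e0 / 2) ltac:(lra) j hj).
  change (0 <= edge_form W j (pmove q (e0 / 2) d)) in K; rewrite edge_form_pmove in K; nra.
Qed.

Lemma nxt_prv (i : nat) : (i < 5)%nat -> nxt (prv i) = i.
Proof. intros; do 5 (destruct i as [|i]; [reflexivity|]); lia. Qed.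

Lemma prv_nxt (i : nat) : (i < 5)%nat -> prv (nxt i) = i.
Proof. intros; do 5 (destruct i as [|i]; [reflexivity|]); lia. Qed.

Lemma nxt_lt (i : nat) : (nxt i < 5)%nat.
Proof. apply Nat.mod_upper_bound; lia. Qed.

Lemma prv_lt (i : nat) : (prv i < 5)%nat.
Proof. apply Nat.mod_upper_bound; lia. Qed.

Lemma nxt_neq (i : nat) : (i < 5)%nat ->
  nxt i <> i /\ nxt (nxt i) <> i /\ nxt (nxt i) <> nxt i /\ prv i <> i /\ prv i <> nxt i.
Proof.
  intros; do 5 (destruct i as [|i]; [cbv; repeat split; discriminate|]); lia.
Qed.

Lemma edge_form_vertex_pos (W : nat -> pt) (j k : nat) : convex_pentagon W ->
  (j < 5)%nat -> (k < 5)%nat -> k <> j -> k <> nxt j -> 0 < edge_form W j (W k).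
Proof.
  intros HW hj hk h1 h2; destruct (nxt_neq j hj) as [n1 [n2 [n3 _]]].
  unfold edge_form; destruct HW as [H|H];
    pose proof (H j k hj hk h1 h2); pose proof (H j (nxt (nxt j)) hj (nxt_lt _) n2 n3); nra.
Qed.

Lemma edge_form_vertex_self (W : nat -> pt) (j : nat) : edge_form W j (W j) = 0.
Proof. unfold edge_form; planar; ring. Qed.

Lemma edge_form_vertex_nxt (W : nat -> pt) (j : nat) : edge_form W j (W (nxt j)) = 0.
Proof. unfold edge_form; planar; ring. Qed.

(** Only the two edges at [W i] are active there, so near this vertex the region is the cone between
    the vectors [a] and [b] to the neighbouring vertices. *)
Lemma has_angle_vertex (W : nat -> pt) (i : nat) : convex_pentagon W -> (i < 5)%nat ->
  has_angle (pent_region W) (W i) (corner_angle W i).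
Proof.
  intros HW hi.
  destruct (nxt_neq i hi) as [n1 [n2 [n3 [n4 n5]]]].
  assert (hp := prv_lt i); assert (enp := nxt_prv i hi).
  assert (Gp : edge_form W (prv i) (W i) = 0) by (rewrite <- enp at 2; apply edge_form_vertex_nxt).
  assert (Gi := edge_form_vertex_self W i).
  assert (Gj : forall j, (j < 5)%nat -> j <> i -> j <> prv i -> 0 < edge_form W j (W i)).
  { intros j hj j1 j2; apply edge_form_vertex_pos; auto.
    intros E; apply j2; rewrite E, prv_nxt; auto. }
  set (a := psub (W (prv i)) (W i)); set (b := psub (W (nxt i)) (W i)).
  set (k := cross b (psub (W (nxt (nxt i))) (W i))).
  set (k' := cross (psub (W i) (W (prv i))) (psub (W (nxt i)) (W (prv i)))).
  assert (Li : forall d, edge_slope W i d = cross b d * k) by reflexivity.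
  assert (Lp : forall d, edge_slope W (prv i) d = cross d a * k').
  { intros d; unfold edge_slope; rewrite enp; fold k'; f_equal; unfold a; planar; ring. }
  assert (Tin : forall d, 0 < edge_slope W i d -> 0 < edge_slope W (prv i) d ->
     tangent (interior (pent_region W)) (W i) d).
  { intros d d1 d2; apply tangent_interior_region; intros j hj.
    destruct (Nat.eq_dec j i) as [->|]; [right; auto|].
    destruct (Nat.eq_dec j (prv i)) as [->|]; [right; auto|left; auto]. }
  assert (Tout : forall d, edge_slope W i d < 0 \/ edge_slope W (prv i) d < 0 ->
     ~ tangent (pent_region W) (W i) d).
  { intros d [h|h]; [apply (not_tangent_region W _ d i) | apply (not_tangent_region W _ d (prv i))]; auto. }
  unfold corner_angle; fold a b.
  destruct HW as [H|H];
    pose proof (H i (nxt (nxt i)) hi (nxt_lt _) n2 n3) as Hk; fold b in Hk; fold k in Hk;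
    pose proof (H (prv i) (nxt i) hp (nxt_lt _) ltac:(auto) ltac:(rewrite enp; auto)) as Hk';
    rewrite enp in Hk'; fold k' in Hk'.
  (* Counterclockwise, the cone runs from [b] to [a]; in the clockwise case below it runs from [a]
     to [b]. *)
  - rewrite vec_angle_sym; apply has_angle_cone.
    + revert Hk'; unfold k', a, b; planar; lra.
    + intros d d1 d2; apply Tin; rewrite ?Li, ?Lp; nra.
    + intros d d1; apply Tout; rewrite Li, Lp; destruct d1; [left|right]; nra.
  - assert (X : forall x y, cross x y = - cross y x) by (intros; planar; ring).
    apply has_angle_cone.
    + revert Hk'; unfold k', a, b; planar; lra.
    + intros d d1 d2; apply Tin; rewrite ?Li, ?Lp, X; nra.
    + intros d d1; apply Tout; rewrite Li, Lp, (X b d), (X d a); destruct d1; [right|left]; nra.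
Qed.

(** Such a [q] is strictly between the ends of edge [j], at parameter [s]. Every edge form at [q] is
    then a proper convex combination of its values at the two ends, and an edge other than [j]
    contains at most one of these. *)
Lemma edge_point_pos (W : nat -> pt) (q : pt) (j : nat) : convex_pentagon W ->
  pent_region W q -> (forall i, (i < 5)%nat -> W i <> q) -> (j < 5)%nat -> edge_form W j q = 0 ->
  forall k, (k < 5)%nat -> k <> j -> 0 < edge_form W k q.
Proof.
  intros HW Hq Hv hj H0.
  destruct (nxt_neq j hj) as [n1 [n2 [n3 [n4 n5]]]].
  set (E := psub (W (nxt j)) (W j)).
  set (c := cross E (psub (W (nxt (nxt j))) (W j))).
  assert (Hc : c <> 0).
  { destruct HW as [H|H]; pose proof (H j (nxt (nxt j)) hj (nxt_lt _) n2 n3) as Hk;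
    fold E in Hk; fold c in Hk; lra. }
  assert (Hx : cross E (psub q (W j)) = 0).
  { unfold edge_form in H0; fold E in H0; fold c in H0; apply Rmult_integral in H0; tauto. }
  assert (HE : 0 < dot E E).
  { destruct (Rle_lt_or_eq_dec _ _ (dot_self_nonneg E)) as [h|h]; [assumption|].
    exfalso; apply Hc; unfold c, cross; unfold dot in h.
    assert (fst E = 0) by nra; assert (snd E = 0) by nra; nra. }
  set (s := dot (psub q (W j)) E / dot E E).
  assert (Eq : q = pmove (W j) s E).
  { assert (I1 : fst (psub q (W j)) * dot E E = dot (psub q (W j)) E * fst E - cross E (psub q (W j)) * snd E)
      by (unfold cross, dot; ring).
    assert (I2 : snd (psub q (W j)) * dot E E = dot (psub q (W j)) E * snd E + cross E (psub q (W j)) * fst E)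
      by (unfold cross, dot; ring).
    rewrite Hx in I1, I2.
    assert (J1 : fst (psub q (W j)) = s * fst E).
    { apply (Rmult_eq_reg_r (dot E E)); [|lra]; rewrite I1; unfold s; field; lra. }
    assert (J2 : snd (psub q (W j)) = s * snd E).
    { apply (Rmult_eq_reg_r (dot E E)); [|lra]; rewrite I2; unfold s; field; lra. }
    unfold pmove; rewrite <- J1, <- J2; destruct q; unfold psub; simpl; f_equal; ring. }
  assert (A : forall k, edge_form W k q = (1 - s) * edge_form W k (W j) + s * edge_form W k (W (nxt j))).
  { intros k; rewrite Eq at 1; unfold edge_form, pmove, E; planar; ring. }
  assert (P0 : forall k i, (k < 5)%nat -> (i < 5)%nat -> 0 <= edge_form W k (W i)).
  { intros k i hk hi; destruct (Nat.eq_dec i k) as [->|h1]; [rewrite edge_form_vertex_self; lra|].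
    destruct (Nat.eq_dec i (nxt k)) as [->|h2]; [rewrite edge_form_vertex_nxt; lra|].
    left; apply edge_form_vertex_pos; auto. }
  assert (s0 : s <> 0).
  { intros e; apply (Hv j hj); rewrite Eq, e; unfold pmove; rewrite (surjective_pairing (W j)) at 1; f_equal; ring. }
  assert (s1 : s <> 1).
  { intros e; apply (Hv (nxt j) (nxt_lt _)); rewrite Eq, e; unfold pmove, E, psub; simpl.
    rewrite (surjective_pairing (W (nxt j))) at 1; f_equal; ring. }
  (* The form of the preceding edge vanishes at [W j] and is positive at [W (nxt j)], so its value
     at [q] has the sign of [s]. The following edge bounds [s] from above in the same way. *)
  assert (Sp : 0 <= s).
  { assert (B := A (prv j)).
    rewrite <- (nxt_prv j hj) in B at 3; rewrite edge_form_vertex_nxt in B.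
    pose proof (edge_form_vertex_pos W (prv j) (nxt j) HW (prv_lt _) (nxt_lt _) ltac:(auto)
      ltac:(rewrite nxt_prv by auto; auto)).
    assert (C : 0 <= edge_form W (prv j) q) by (apply Hq, prv_lt); rewrite B in C; nra. }
  assert (Sn : s <= 1).
  { assert (B := A (nxt j)); rewrite edge_form_vertex_self in B.
    pose proof (edge_form_vertex_pos W (nxt j) j HW (nxt_lt _) hj ltac:(auto) ltac:(auto)).
    assert (C : 0 <= edge_form W (nxt j) q) by (apply Hq, nxt_lt); rewrite B in C; nra. }
  intros k hk hkj; rewrite A.
  pose proof (P0 k j hk hj); pose proof (P0 k (nxt j) hk (nxt_lt _)).
  destruct (Nat.eq_dec j (nxt k)) as [e|e].
  - assert (0 < edge_form W k (W (nxt j))); [|nra].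
    apply edge_form_vertex_pos; auto using nxt_lt; rewrite e.
    + destruct (nxt_neq k hk) as [_ [? _]]; assumption.
    + destruct (nxt_neq (nxt k) (nxt_lt _)) as [? _]; assumption.
  - assert (0 < edge_form W k (W j)); [|nra].
    apply edge_form_vertex_pos; auto.
Qed.

Lemma Rsum_sqr_pos (x y : R) : x <> 0 \/ y <> 0 -> 0 < x * x + y * y.
Proof.
  intros [h|h]; pose proof (Rsqr_pos_lt _ h); pose proof (Rle_0_sqr x);
    pose proof (Rle_0_sqr y); unfold Rsqr in *; lra.
Qed.

Lemma has_angle_nonvertex (W : nat -> pt) (q : pt) : convex_pentagon W ->
  pent_region W q -> (forall i, (i < 5)%nat -> W i <> q) ->
  has_angle (pent_region W) q PI \/ has_angle (pent_region W) q (2 * PI).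
Proof.
  intros HW Hq Hv; pose proof PI_RGT_0.
  destruct (classic (exists j, (j < 5)%nat /\ edge_form W j q = 0)) as [[j [hj H0]]|N].
  - left; assert (K := edge_point_pos W q j HW Hq Hv hj H0).
    destruct (nxt_neq j hj) as [n1 [n2 [n3 _]]].
    set (E := psub (W (nxt j)) (W j)); set (c := cross E (psub (W (nxt (nxt j))) (W j))).
    assert (Hc : c <> 0).
    { destruct HW as [H'|H']; pose proof (H' j (nxt (nxt j)) hj (nxt_lt _) n2 n3) as Hk;
        fold E in Hk; fold c in Hk; lra. }
    assert (L : forall d, edge_slope W j d = cross (c * fst E, c * snd E) d)
      by (intros d; unfold edge_slope; fold E; fold c; planar; ring).
    (* The factor [c] turns the edge vector round when the listing is clockwise, so that the region
       is always on its left. *)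
    apply has_angle_halfplane with (c * fst E, c * snd E).
    + apply sqrt_lt_R0; unfold dot; simpl.
      destruct (Req_dec (fst E) 0) as [e1|e1].
      * destruct (Req_dec (snd E) 0) as [e2|e2].
        { exfalso; apply Hc; unfold c, cross; rewrite e1, e2; ring. }
        assert (c * snd E <> 0) by (apply Rmult_integral_contrapositive; auto).
        apply Rsum_sqr_pos; auto.
      * assert (c * fst E <> 0) by (apply Rmult_integral_contrapositive; auto).
        apply Rsum_sqr_pos; auto.
    + intros d hd; rewrite <- L in hd; apply tangent_interior_region; intros k hk.
      destruct (Nat.eq_dec k j) as [->|]; [right; auto|left; auto].
    + intros d hd; rewrite <- L in hd; apply (not_tangent_region W q d j); assumption.
  - right; apply has_angle_arc with 0; [lra| |intros; lra].
    intros t _; apply tangent_interior_region; intros j hj; left.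
    assert (C : 0 <= edge_form W j q) by (apply Hq, hj).
    destruct (Rle_lt_or_eq_dec _ _ C) as [|e]; [assumption|].
    exfalso; apply N; exists j; auto.
Qed.

(** * Local finiteness *)

Lemma norm_padd (a b : pt) : norm (padd a b) <= norm a + norm b.
Proof.
  pose proof (norm_nonneg a); pose proof (norm_nonneg b); pose proof (norm_nonneg (padd a b)).
  pose proof (norm_sqr a) as Ha; pose proof (norm_sqr b) as Hb;
    pose proof (norm_sqr (padd a b)) as Hab.
  assert (C : dot a b * dot a b <= (norm a * norm b) * (norm a * norm b)).
  { replace ((norm a * norm b) * (norm a * norm b)) with ((norm a * norm a) * (norm b * norm b)) by ring.
    rewrite Ha, Hb; pose proof (Rle_0_sqr (cross a b)) as X.
    unfold Rsqr in X; rewrite binet_cauchy in X.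
    replace (dot b a) with (dot a b) in X by (unfold dot; ring); lra. }
  assert (D : dot a b <= norm a * norm b).
  { apply Rsqr_incr_0_var; [assumption|]; apply Rmult_le_pos; assumption. }
  assert (E : dot (padd a b) (padd a b) = dot a a + 2 * dot a b + dot b b) by (planar; ring).
  apply Rsqr_incr_0_var; [|lra]; unfold Rsqr; lra.
Qed.

Lemma dist_triangle (x y z : pt) : dist x z <= dist x y + dist y z.
Proof.
  unfold dist; replace (psub x z) with (padd (psub x y) (psub y z)); [apply norm_padd|].
  unfold padd, psub; simpl; f_equal; ring.
Qed.

Lemma norm_le_abs (a : pt) : norm a <= Rabs (fst a) + Rabs (snd a).
Proof.
  pose proof (norm_nonneg a); pose proof (norm_sqr a) as Ha; unfold dot in Ha.
  pose proof (Rabs_pos (fst a)); pose proof (Rabs_pos (snd a)).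
  assert (fst a * fst a = Rabs (fst a) * Rabs (fst a)).
  { rewrite <- Rabs_mult, Rabs_right; nra. }
  assert (snd a * snd a = Rabs (snd a) * Rabs (snd a)).
  { rewrite <- Rabs_mult, Rabs_right; nra. }
  nra.
Qed.

(** At the centroid of the vertices an edge form is the mean of five nonnegative values, of which
    the one at [V (nxt (nxt j))] is positive. *)
Lemma region_interior_nonempty (V : nat -> pt) : convex_pentagon V ->
  exists c, interior (pent_region V) c.
Proof.
  intros HV.
  exists ((fst (V 0%nat) + fst (V 1%nat) + fst (V 2%nat) + fst (V 3%nat) + fst (V 4%nat)) / 5,
     (snd (V 0%nat) + snd (V 1%nat) + snd (V 2%nat) + snd (V 3%nat) + snd (V 4%nat)) / 5).
  apply interior_region; intros j hj.
  assert (P0 : forall i, (i < 5)%nat -> 0 <= edge_form V j (V i)).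
  { intros i hi; destruct (Nat.eq_dec i j) as [->|h1]; [rewrite edge_form_vertex_self; lra|].
    destruct (Nat.eq_dec i (nxt j)) as [->|h2]; [rewrite edge_form_vertex_nxt; lra|].
    left; apply edge_form_vertex_pos; auto. }
  assert (Q : 0 < edge_form V j (V (nxt (nxt j)))).
  { destruct (nxt_neq j hj) as [n1 [n2 [n3 _]]]; apply edge_form_vertex_pos; auto using nxt_lt. }
  match goal with |- 0 < edge_form V j ?x => assert (E : edge_form V j x =
    (edge_form V j (V 0%nat) + edge_form V j (V 1%nat) + edge_form V j (V 2%nat) + edge_form V j (V 3%nat) + edge_form V j (V 4%nat)) / 5) end.
  { unfold edge_form; planar; field. }
  rewrite E.
  pose proof (P0 0%nat ltac:(lia)); pose proof (P0 1%nat ltac:(lia)); pose proof (P0 2%nat ltac:(lia));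
    pose proof (P0 3%nat ltac:(lia)); pose proof (P0 4%nat ltac:(lia)).
  clear E P0; do 5 (destruct j as [|j]; [unfold nxt in *; simpl in *; lra|]); lia.
Qed.

(** The quotients [a], [b], [c] are the barycentric coordinates of [y]; the sign conditions make [y]
    a convex combination of the corners. *)
Lemma triangle_bounded (p q r y : pt) : det p q r <> 0 ->
  0 <= det p q y * det p q r -> 0 <= det q r y * det p q r -> 0 <= det r p y * det p q r ->
  Rabs (fst y) <= Rabs (fst p) + Rabs (fst q) + Rabs (fst r) /\
  Rabs (snd y) <= Rabs (snd p) + Rabs (snd q) + Rabs (snd r).
Proof.
  intros K H1 H2 H3; set (k := det p q r) in *.
  set (a := det q r y / k); set (b := det r p y / k); set (c := det p q y / k).
  assert (Kk : 0 < k * k) by (pose proof (Rsqr_pos_lt k K); assumption).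
  assert (N : forall x, 0 <= x * k -> 0 <= x / k).
  { intros x hx; replace (x / k) with ((x * k) * / (k * k)) by (field; assumption).
    apply Rmult_le_pos; [assumption|]; left; apply Rinv_0_lt_compat, Kk. }
  assert (Ha : 0 <= a) by (apply N; assumption).
  assert (Hb : 0 <= b) by (apply N; assumption).
  assert (Hc : 0 <= c) by (apply N; assumption).
  assert (Hs : a + b + c = 1).
  { unfold a, b, c; apply (Rmult_eq_reg_r k); [|assumption]; field_simplify; [|assumption].
    unfold k, det; planar; ring. }
  assert (E1 : fst y = a * fst p + b * fst q + c * fst r).
  { unfold a, b, c; apply (Rmult_eq_reg_r k); [|assumption]; field_simplify; [|assumption].
    unfold k, det; planar; ring. }
  assert (E2 : snd y = a * snd p + b * snd q + c * snd r).
  { unfold a, b, c; apply (Rmult_eq_reg_r k); [|assumption]; field_simplify; [|assumption].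
    unfold k, det; planar; ring. }
  assert (B : forall x1 x2 x3, Rabs (a * x1 + b * x2 + c * x3) <= Rabs x1 + Rabs x2 + Rabs x3).
  { intros x1 x2 x3.
    eapply Rle_trans; [apply Rabs_triang|].
    eapply Rle_trans; [apply Rplus_le_compat_r, Rabs_triang|].
    rewrite !Rabs_mult, (Rabs_right a), (Rabs_right b), (Rabs_right c) by lra.
    pose proof (Rabs_pos x1); pose proof (Rabs_pos x2); pose proof (Rabs_pos x3); nra. }
  rewrite E1, E2; split; apply B.
Qed.

Lemma Rmult_le_reg_nonneg (x k : R) : 0 < k -> 0 <= x * k -> 0 <= x.
Proof. nra. Qed.

Lemma Rmult_le_reg_nonpos (x k : R) : k < 0 -> 0 <= x * k -> x <= 0.
Proof. nra. Qed.

Lemma Rmult_nonpos_nonpos (x y : R) : x <= 0 -> y <= 0 -> 0 <= x * y.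
Proof. nra. Qed.

(** The pentagon is covered by the fan triangles 012, 023 and 034, and each of these is bounded. *)
Lemma region_bounded (V : nat -> pt) : convex_pentagon V -> exists M, forall y,
  pent_region V y -> Rabs (fst y) <= M /\ Rabs (snd y) <= M.
Proof.
  intros HV.
  set (B := fun i => Rabs (fst (V i)) + Rabs (snd (V i))).
  exists (B 0%nat + B 1%nat + B 2%nat + B 3%nat + B 4%nat); intros y Hy.
  assert (T : forall i j k, det (V i) (V j) (V k) <> 0 ->
     0 <= det (V i) (V j) y * det (V i) (V j) (V k) ->
     0 <= det (V j) (V k) y * det (V i) (V j) (V k) ->
     0 <= - det (V i) (V k) y * det (V i) (V j) (V k) ->
     Rabs (fst y) <= B i + B j + B k /\ Rabs (snd y) <= B i + B j + B k).
  { intros i j k h0 h1 h2 h3.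
    replace (- det (V i) (V k) y) with (det (V k) (V i) y) in h3 by (unfold det; planar; ring).
    destruct (triangle_bounded _ _ _ _ h0 h1 h2 h3); unfold B.
    pose proof (Rabs_pos (fst (V i))); pose proof (Rabs_pos (snd (V i)));
    pose proof (Rabs_pos (fst (V j))); pose proof (Rabs_pos (snd (V j)));
    pose proof (Rabs_pos (fst (V k))); pose proof (Rabs_pos (snd (V k))); lra. }
  assert (BP : forall i, 0 <= B i).
  { intros i; unfold B; pose proof (Rabs_pos (fst (V i))); pose proof (Rabs_pos (snd (V i))); lra. }
  pose proof (BP 0%nat); pose proof (BP 1%nat); pose proof (BP 2%nat);
    pose proof (BP 3%nat); pose proof (BP 4%nat).
  assert (T012 := T 0%nat 1%nat 2%nat); assert (T023 := T 0%nat 2%nat 3%nat);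
    assert (T034 := T 0%nat 3%nat 4%nat).
  clearbody B; clear T BP.
  pose proof (Hy 0%nat ltac:(lia)) as Y0; pose proof (Hy 1%nat ltac:(lia)) as Y1;
  pose proof (Hy 2%nat ltac:(lia)) as Y2; pose proof (Hy 3%nat ltac:(lia)) as Y3;
  pose proof (Hy 4%nat ltac:(lia)) as Y4.
  change (0 <= det (V 0%nat) (V 1%nat) y * det (V 0%nat) (V 1%nat) (V 2%nat)) in Y0.
  change (0 <= det (V 1%nat) (V 2%nat) y * det (V 1%nat) (V 2%nat) (V 3%nat)) in Y1.
  change (0 <= det (V 2%nat) (V 3%nat) y * det (V 2%nat) (V 3%nat) (V 4%nat)) in Y2.
  change (0 <= det (V 3%nat) (V 4%nat) y * det (V 3%nat) (V 4%nat) (V 0%nat)) in Y3.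
  change (0 <= det (V 4%nat) (V 0%nat) y * det (V 4%nat) (V 0%nat) (V 1%nat)) in Y4.
  assert (A : forall p q r, det q p r = - det p q r) by (intros; unfold det; planar; ring).
  assert (Q : forall p q r, det q r p = det p q r) by (intros; unfold det; planar; ring).
  rewrite (A (V 0%nat) (V 4%nat) y) in Y4; rewrite (Q (V 0%nat) (V 3%nat) (V 4%nat)) in Y3.
  destruct HV as [K|K];
    pose proof (K 0%nat 2%nat ltac:(lia) ltac:(lia) ltac:(lia) ltac:(cbv; lia)) as D0;
    pose proof (K 1%nat 3%nat ltac:(lia) ltac:(lia) ltac:(lia) ltac:(cbv; lia)) as D1;
    pose proof (K 2%nat 4%nat ltac:(lia) ltac:(lia) ltac:(lia) ltac:(cbv; lia)) as D2;
    pose proof (K 3%nat 0%nat ltac:(lia) ltac:(lia) ltac:(lia) ltac:(cbv; lia)) as D3;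
    pose proof (K 4%nat 1%nat ltac:(lia) ltac:(lia) ltac:(lia) ltac:(cbv; lia)) as D4;
    pose proof (K 2%nat 0%nat ltac:(lia) ltac:(lia) ltac:(lia) ltac:(cbv; lia)) as D5;
    match type of D0 with
    | 0 < _ =>
      change (0 < det (V 0%nat) (V 1%nat) (V 2%nat)) in D0;
      change (0 < det (V 1%nat) (V 2%nat) (V 3%nat)) in D1;
      change (0 < det (V 2%nat) (V 3%nat) (V 4%nat)) in D2;
      change (0 < det (V 3%nat) (V 4%nat) (V 0%nat)) in D3;
      change (0 < det (V 4%nat) (V 0%nat) (V 1%nat)) in D4;
      change (0 < det (V 2%nat) (V 3%nat) (V 0%nat)) in D5
    | _ =>
      change (det (V 0%nat) (V 1%nat) (V 2%nat) < 0) in D0;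
      change (det (V 1%nat) (V 2%nat) (V 3%nat) < 0) in D1;
      change (det (V 2%nat) (V 3%nat) (V 4%nat) < 0) in D2;
      change (det (V 3%nat) (V 4%nat) (V 0%nat) < 0) in D3;
      change (det (V 4%nat) (V 0%nat) (V 1%nat) < 0) in D4;
      change (det (V 2%nat) (V 3%nat) (V 0%nat) < 0) in D5
    end; rewrite Q in D3, D5; clear A Q K Hy;
    (* The sides of the two diagonals from [V 0] on which [y] lies decide which triangle of the fan
       contains it. *)
    destruct (Rle_dec (det (V 0%nat) (V 2%nat) y) 0) as [s2|s2];
    destruct (Rle_dec (det (V 0%nat) (V 3%nat) y) 0) as [s3|s3].
  all: first
    [ apply (Rmult_le_reg_nonneg _ _ D0) in Y0; apply (Rmult_le_reg_nonneg _ _ D1) in Y1;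
      apply (Rmult_le_reg_nonneg _ _ D2) in Y2; apply (Rmult_le_reg_nonneg _ _ D3) in Y3;
      apply (Rmult_le_reg_nonneg _ _ D4) in Y4
    | apply (Rmult_le_reg_nonpos _ _ D0) in Y0; apply (Rmult_le_reg_nonpos _ _ D1) in Y1;
      apply (Rmult_le_reg_nonpos _ _ D2) in Y2; apply (Rmult_le_reg_nonpos _ _ D3) in Y3;
      apply (Rmult_le_reg_nonpos _ _ D4) in Y4 ].
  all: let close T := destruct T; first
    [lra | split; lra | apply Rmult_le_pos; lra | apply Rmult_nonpos_nonpos; lra] in
    first [solve [close T012] | solve [close T023] | close T034].
Qed.

(** If the pentagon has a symmetry, different placed isometries give the same tile. Hence tiles are
    compared below through [tile V f] and not through [f]. *)
Definition placed (V : nat -> pt) (T : (pt -> Prop) -> Prop) (f : pt -> pt) : Prop :=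
  isometry f /\ T (tile V f).

Lemma tiling_placed (V : nat -> pt) (T : (pt -> Prop) -> Prop) (t : pt -> Prop) :
  monohedral_tiling_by (pent_region V) T -> T t -> exists f, placed V T f /\ t = tile V f.
Proof.
  intros [_ H] Ht; destruct (congruent_tile V t (H t Ht)) as [f [hf E]].
  exists f; split; [split; [|rewrite <- E]|]; assumption.
Qed.

Lemma interior_isometry (V : nat -> pt) (f : pt -> pt) (c : pt) (r : R) : isometry f ->
  (forall y, dist c y < r -> pent_region V y) ->
  forall x, dist (f c) x < r -> interior (tile V f) x.
Proof.
  intros hf H x hx; exists (r - dist (f c) x); split; [lra|]; intros y hy.
  destruct (isometry_surjective f hf y) as [z <-].
  apply tile_isometry; [assumption|]; apply H.
  rewrite <- hf; pose proof (dist_triangle (f c) x (f z)); lra.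
Qed.

(** Packing: a disc of radius [r] about [c] is carried into the interior of each tile, so for close
    centres the point [g c] is interior to both tiles. *)
Lemma placed_close (V : nat -> pt) (T : (pt -> Prop) -> Prop) (f g : pt -> pt) (c : pt) (r : R) :
  is_tiling T -> 0 < r -> (forall y, dist c y < r -> pent_region V y) ->
  placed V T f -> placed V T g -> dist (f c) (g c) < r -> tile V f = tile V g.
Proof.
  intros [_ [_ HD]] hr H [hf Tf] [hg Tg] hd; apply NNPP; intros N.
  apply (HD _ _ Tf Tg N (g c)); split.
  - now apply interior_isometry with c r.
  - apply interior_isometry with c r; auto; now rewrite dist_self.
Qed.

(** Pigeonhole: choose one element of [P] in each occupied cell of a finite list of cells. *)
Lemma finite_representatives {A C : Type} (P : A -> Prop) (cell : A -> C) (E : A -> A -> Prop) :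
  (forall a b, P a -> P b -> cell a = cell b -> E a b) ->
  forall cells, exists L, (forall a, In a L -> P a) /\
    forall a, P a -> In (cell a) cells -> exists b, In b L /\ E a b.
Proof.
  intros H; induction cells as [|x cells [L [L1 L2]]].
  - exists []; split; simpl; tauto.
  - destruct (classic (exists b, P b /\ cell b = x)) as [[b [Pb eb]]|N].
    + exists (b :: L); split.
      * intros a [<-|h]; auto.
      * intros a Pa [e|h]; [exists b; split; [now left|]; apply H; congruence|].
        destruct (L2 a Pa h) as [b' [i e]]; exists b'; split; [now right|assumption].
    + exists L; split; [assumption|]; intros a Pa [e|h]; [|auto].
      exfalso; apply N; exists a; auto.
Qed.

Lemma Z_range_list (K : Z) : exists l, forall z, (- K <= z <= K)%Z -> In z l.
Proof.
  exists (map (fun n => Z.of_nat n - K)%Z (seq 0 (Z.to_nat (2 * K + 1)))).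
  intros z hz; apply in_map_iff; exists (Z.to_nat (z + K)); split; [lia|].
  apply in_seq; lia.
Qed.

Lemma Int_part_bound (M x : R) : Rabs x <= M -> (- (up M + 1) <= Int_part x <= up M + 1)%Z.
Proof.
  intros H; destruct (base_Int_part x) as [h1 h2]; destruct (archimed M) as [h3 h4].
  apply Rabs_le_between in H.
  split; apply le_IZR; rewrite ?opp_IZR, ?plus_IZR; lra.
Qed.

Lemma finitely_many_tiles (V : nat -> pt) (T : (pt -> Prop) -> Prop) (c : pt) (M : R) :
  is_tiling T -> interior (pent_region V) c ->
  exists L, (forall f, In f L -> placed V T f) /\
    forall f, placed V T f -> Rabs (fst (f c)) <= M -> Rabs (snd (f c)) <= M ->
      exists g, In g L /\ tile V f = tile V g.
Proof.
  intros HT [r [hr Hr]].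
  (* In a grid of mesh [r / 2] two points of one cell have coordinates differing by less than
     [r / 2], hence are closer than [r]; by [placed_close] a cell determines the tile. *)
  set (h := r / 2).
  set (cell := fun f : pt -> pt => (Int_part (fst (f c) / h), Int_part (snd (f c) / h))).
  assert (hh : 0 < h) by (unfold h; lra).
  destruct (Z_range_list (up (M / h) + 1)) as [l hl].
  destruct (finite_representatives (placed V T) cell (fun f g => tile V f = tile V g)) with
    (cells := list_prod l l) as [L [L1 L2]].
  - intros f g Pf Pg E; apply placed_close with T c r; auto.
    unfold cell in E; injection E as E1 E2.
    assert (Q : forall x y, Int_part (x / h) = Int_part (y / h) -> Rabs (x - y) < h).
    { intros x y e; destruct (base_Int_part (x / h)); destruct (base_Int_part (y / h)).
      rewrite e in *.
      replace (x - y) with ((x / h - y / h) * h) by (field; lra).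
      rewrite Rabs_mult, (Rabs_right h) by lra.
      assert (Rabs (x / h - y / h) < 1) by (apply Rabs_def1; lra); nra. }
    apply Q in E1; apply Q in E2.
    pose proof (norm_le_abs (psub (f c) (g c))) as N; unfold dist, psub in *; simpl in *.
    unfold h in *; lra.
  - exists L; split; [assumption|]; intros f Pf h1 h2; apply L2; [assumption|].
    assert (Q : forall x, Rabs x <= M -> In (Int_part (x / h)) l).
    { intros x hx; apply hl, Int_part_bound.
      unfold Rdiv; rewrite Rabs_mult, (Rabs_right (/ h)).
      - apply Rmult_le_compat_r; [left; now apply Rinv_0_lt_compat|assumption].
      - left; now apply Rinv_0_lt_compat. }
    apply in_prod; apply Q; assumption.
Qed.

(** * Covering a direction at a point by a single tile *)

(** An affine function has constant sign on a short open piece of a ray, and the region is cut out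
    by five of them; so the ray cannot enter and leave the region infinitely often near [q]. *)
Lemma region_dichotomy (W : nat -> pt) (q d : pt) :
  (pent_region W q /\ tangent (pent_region W) q d) \/
  (exists e0, 0 < e0 /\ forall e, 0 < e < e0 -> ~ pent_region W (pmove q e d)).
Proof.
  destruct (classic (exists j, (j < 5)%nat /\ (edge_form W j q < 0 \/ edge_form W j q = 0 /\ edge_slope W j d < 0)))
    as [[j [hj H]]|N].
  - right; destruct H as [h|[h h']].
    + exists (- edge_form W j q / (Rabs (edge_slope W j d) + 1)).
      pose proof (Rabs_pos (edge_slope W j d)).
      split; [apply Rdiv_lt_0_compat; lra|].
      intros e he K; specialize (K j hj).
      change (0 <= edge_form W j (pmove q e d)) in K; rewrite edge_form_pmove in K.
      assert (e * (Rabs (edge_slope W j d) + 1) < - edge_form W j q).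
      { replace (- edge_form W j q) with (- edge_form W j q / (Rabs (edge_slope W j d) + 1) * (Rabs (edge_slope W j d) + 1)) by (field; lra).
        apply Rmult_lt_compat_r; lra. }
      pose proof (Rle_abs (edge_slope W j d)); nra.
    + exists 1; split; [lra|]; intros e he K; specialize (K j hj).
      change (0 <= edge_form W j (pmove q e d)) in K; rewrite edge_form_pmove in K; nra.
  - left.
    assert (K : forall j, (j < 5)%nat -> 0 < edge_form W j q \/ edge_form W j q = 0 /\ 0 <= edge_slope W j d).
    { intros j hj; destruct (Rtotal_order (edge_form W j q) 0) as [h|[h|h]]; [exfalso; apply N; eauto| |now left].
      right; split; [assumption|]; destruct (Rle_dec 0 (edge_slope W j d)); [assumption|].
      exfalso; apply N; exists j; split; [assumption|]; right; split; [assumption|lra]. }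
    split.
    + intros j hj; change (0 <= edge_form W j q); destruct (K j hj); lra.
    + destruct (finite_eps 5 (fun j e => 0 <= edge_form W j (pmove q e d))) as [e0 [h0 E]].
      * intros j hj; destruct (K j hj) as [h|[h h']].
        -- exists (edge_form W j q / (Rabs (edge_slope W j d) + 1)).
           pose proof (Rabs_pos (edge_slope W j d)).
           split; [apply Rdiv_lt_0_compat; lra|].
           intros e he; rewrite edge_form_pmove.
           assert (e * (Rabs (edge_slope W j d) + 1) < edge_form W j q).
           { replace (edge_form W j q) with (edge_form W j q / (Rabs (edge_slope W j d) + 1) * (Rabs (edge_slope W j d) + 1)) by (field; lra).
             apply Rmult_lt_compat_r; lra. }
           pose proof (Rle_abs (- edge_slope W j d)); rewrite Rabs_Ropp in *; nra.
        -- exists 1; split; [lra|]; intros e he; rewrite edge_form_pmove, h; nra.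
      * exists e0; split; [assumption|]; intros e he j hj; apply (E e he j hj).
Qed.

(** If no tile contained an initial piece of the ray, each of the finitely many nearby tiles would
    miss all points of the ray close enough to [q], and these points would be uncovered. *)
Lemma tangent_cover (V : nat -> pt) (T : (pt -> Prop) -> Prop) (q d : pt) :
  convex_pentagon V -> monohedral_tiling_by (pent_region V) T ->
  exists t, T t /\ t q /\ tangent t q d.
Proof.
  intros HV HM; assert (HT := proj1 HM).
  destruct (region_interior_nonempty V HV) as [c Hc].
  destruct (region_bounded V HV) as [B HB].
  set (D := Rabs (fst c) + Rabs (snd c) + 2 * B).
  assert (HD : forall y, pent_region V y -> dist c y <= D).
  { intros y hy; destruct (HB y hy) as [b1 b2].
    pose proof (norm_le_abs (psub c y)) as N; unfold dist, psub in *; simpl in *.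
    pose proof (Rabs_triang (fst c) (- fst y)); pose proof (Rabs_triang (snd c) (- snd y)).
    rewrite !Rabs_Ropp in *; unfold Rminus, D in *; lra. }
  (* Bounds the coordinates of the centre of every tile that meets the ray at a parameter at most 1,
     since a tile stays within [D] of its centre. This is why [e] is capped at 1 below. *)
  set (M := Rabs (fst q) + Rabs (snd q) + Rabs (fst d) + Rabs (snd d) + D).
  destruct (finitely_many_tiles V T c M HT Hc) as [L [L1 L2]].
  apply NNPP; intros N.
  destruct (list_eps (fun f e => ~ tile V f (pmove q e d)) L) as [e0 [h0 K]].
  - intros f hf; destruct (region_dichotomy (fun i => f (V i)) q d) as [[h1 h2]|h]; [|exact h].
    exfalso; apply N; exists (tile V f); split; [apply (L1 f hf)|split; assumption].
  - set (e := Rmin (e0 / 2) 1).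
    pose proof (Rmin_l (e0 / 2) 1); pose proof (Rmin_r (e0 / 2) 1).
    assert (he : 0 < e) by (apply Rmin_pos; lra); fold e in H, H0.
    destruct (proj1 (proj2 HT) (pmove q e d)) as [t [Tt Ht]].
    destruct (tiling_placed V T t HM Tt) as [f [Pf ->]].
    assert (Hx : dist (f c) (pmove q e d) <= D).
    { destruct (isometry_surjective f (proj1 Pf) (pmove q e d)) as [y Ey].
      rewrite <- Ey, (proj1 Pf); apply HD; rewrite <- Ey in Ht.
      now apply (tile_isometry V f y (proj1 Pf)). }
    destruct (abs_le_norm (psub (f c) (pmove q e d))) as [A1 A2].
    fold (dist (f c) (pmove q e d)) in A1, A2.
    assert (Z : forall x y z, Rabs (x - (y + e * z)) <= D -> Rabs x <= Rabs y + Rabs z + D).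
    { intros x y z hz.
      pose proof (Rabs_triang (x - (y + e * z)) (y + e * z)).
      pose proof (Rabs_triang y (e * z)).
      replace (x - (y + e * z) + (y + e * z)) with x in * by ring.
      rewrite (Rabs_mult e z), (Rabs_right e) in * by lra.
      pose proof (Rabs_pos z); nra. }
    pose proof (Rabs_pos (fst q)); pose proof (Rabs_pos (snd q));
    pose proof (Rabs_pos (fst d)); pose proof (Rabs_pos (snd d)).
    destruct (L2 f Pf) as [g [Hg Eg]].
    + assert (Rabs (fst (f c)) <= Rabs (fst q) + Rabs (fst d) + D)
        by (apply Z; simpl in A1; lra); unfold M; lra.
    + assert (Rabs (snd (f c)) <= Rabs (snd q) + Rabs (snd d) + D)
        by (apply Z; simpl in A2; lra); unfold M; lra.
    + apply (K e ltac:(lra) g Hg); rewrite <- Eg; assumption.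
Qed.

(** * Angle sums around a point *)

Definition lsum {A : Type} (h : A -> R) (l : list A) : R :=
  fold_right (fun a s => h a + s) 0 l.

Lemma lsum_map {A B : Type} (h : B -> R) (F : A -> B) (l : list A) :
  lsum h (map F l) = lsum (fun a => h (F a)) l.
Proof. induction l as [|a l IH]; simpl; [reflexivity|now rewrite IH]. Qed.

Lemma lsum_app {A : Type} (h : A -> R) (l l' : list A) :
  lsum h (l ++ l') = lsum h l + lsum h l'.
Proof. induction l as [|a l IH]; simpl; [ring|rewrite IH; ring]. Qed.

Lemma lsum_nonneg {A : Type} (h : A -> R) (l : list A) :
  (forall a, In a l -> 0 <= h a) -> 0 <= lsum h l.
Proof.
  induction l as [|a l IH]; simpl; intros H; [lra|].
  pose proof (H a (or_introl eq_refl)); assert (0 <= lsum h l) by auto; lra.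
Qed.

Lemma lsum_ge {A : Type} (h : A -> R) (l : list A) (a : A) :
  (forall a, In a l -> 0 <= h a) -> In a l -> h a <= lsum h l.
Proof.
  induction l as [|b l IH]; simpl; [tauto|]; intros H [<-|i].
  - assert (0 <= lsum h l) by (apply lsum_nonneg; auto); lra.
  - pose proof (H b (or_introl eq_refl)); assert (h a <= lsum h l) by auto; lra.
Qed.

Lemma lsum_indic_le {A : Type} (P : A -> Prop) (l : list A) :
  ForallOrdPairs (fun a b => ~ (P a /\ P b)) l -> lsum (fun a => indic (P a)) l <= 1.
Proof.
  induction 1 as [|a l Ha Hl IH]; simpl; [lra|].
  destruct (classic (P a)) as [h|h]; [|rewrite (indic_false _ h); lra].
  assert (E : lsum (fun a => indic (P a)) l = 0).
  { clear Hl IH; induction Ha as [|b l hb _ IH]; simpl; [reflexivity|].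
    rewrite IH, indic_false; [ring|tauto]. }
  rewrite E, (indic_true _ h); lra.
Qed.

Lemma is_RInt_lsum {A : Type} (F : A -> R -> R) (m : A -> R) (a b : R) (l : list A) :
  (forall x, In x l -> is_RInt (F x) a b (m x)) ->
  is_RInt (fun t => lsum (fun x => F x t) l) a b (lsum m l).
Proof.
  induction l as [|x l IH]; intros H; simpl.
  - assert (K : is_RInt (fun _ => 0) a b ((b - a) * 0)) by apply (is_RInt_const a b 0).
    rewrite Rmult_0_r in K; exact K.
  - apply (is_RInt_plus (F x) (fun t => lsum (fun x => F x t) l)).
    + apply H; now left.
    + apply IH; intros y hy; apply H; now right.
Qed.

Lemma is_RInt_one : is_RInt (fun _ => 1) 0 (2 * PI) (2 * PI).
Proof.
  assert (K : is_RInt (fun _ => 1) 0 (2 * PI) ((2 * PI - 0) * 1))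
    by apply (is_RInt_const 0 (2 * PI) 1).
  rewrite Rmult_1_r, Rminus_0_r in K; exact K.
Qed.

(** In one direction at most one of the listed tiles can contain a short piece of the ray in its
    interior, so the integrand is at most 1. *)
Lemma angles_le (T : (pt -> Prop) -> Prop) (q : pt) (l : list ((pt -> Prop) * R)) :
  is_tiling T ->
  (forall p, In p l -> T (fst p) /\ has_angle (fst p) q (snd p)) ->
  ForallOrdPairs (fun p p' => fst p <> fst p') l -> lsum snd l <= 2 * PI.
Proof.
  intros [_ [_ HD]] H FO; pose proof PI_RGT_0.
  apply (is_RInt_le (fun t => lsum (fun p => indic (tangent (interior (fst p)) q (dir t))) l)
     (fun _ => 1) 0 (2 * PI)); [lra| |exact is_RInt_one|].
  - apply (is_RInt_lsum (fun p t => indic (tangent (interior (fst p)) q (dir t)))).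
    intros p hp; apply (H p hp).
  - intros t _; apply lsum_indic_le.
    clear H0; induction FO as [|p l Hp _ IH]; constructor.
    + rewrite Forall_forall in *; intros p' hp' [[e1 [h1 K1]] [e2 [h2 K2]]].
      set (e := Rmin e1 e2 / 2).
      assert (0 < Rmin e1 e2) by (apply Rmin_pos; assumption).
      pose proof (Rmin_l e1 e2); pose proof (Rmin_r e1 e2).
      apply (HD (fst p) (fst p')) with (pmove q e (dir t)).
      * apply H; now left.
      * apply H; now right.
      * now apply Hp.
      * split; [apply K1 | apply K2]; unfold e; lra.
    + apply IH; intros p' hp'; apply H; now right.
Qed.

Lemma angles_ge (q : pt) (l : list ((pt -> Prop) * R)) :
  (forall p, In p l -> has_angle (fst p) q (snd p)) ->
  (forall d, exists p, In p l /\ tangent (fst p) q d) -> 2 * PI <= lsum snd l.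
Proof.
  intros H HC; pose proof PI_RGT_0.
  apply (is_RInt_le (fun _ => 1) (fun t => lsum (fun p => indic (tangent (fst p) q (dir t))) l)
     0 (2 * PI)); [lra|exact is_RInt_one| |].
  - apply (is_RInt_lsum (fun p t => indic (tangent (fst p) q (dir t)))).
    intros p hp; apply (H p hp).
  - intros t _; destruct (HC (dir t)) as [p [hp K]].
    rewrite <- (indic_true _ K).
    apply (lsum_ge (fun p => indic (tangent (fst p) q (dir t)))); [|assumption].
    intros; apply indic_nonneg.
Qed.

Lemma has_angle_unique (S : pt -> Prop) (q : pt) (m m' : R) :
  has_angle S q m -> has_angle S q m' -> m = m'.
Proof.
  intros [H _] [H' _].
  rewrite <- (is_RInt_unique _ _ _ _ H); apply is_RInt_unique, H'.
Qed.

Lemma corner_angle_bounds (V : nat -> pt) (i : nat) : convex_pentagon V -> (i < 5)%nat ->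
  0 < corner_angle V i < PI.
Proof.
  intros HV hi; destruct (nxt_neq i hi) as [_ [_ [_ [n4 n5]]]].
  unfold corner_angle; destruct HV as [H|H]; specialize (H i (prv i) hi (prv_lt i) n4 n5).
  - rewrite vec_angle_sym; apply vec_angle_spec, H.
  - apply vec_angle_spec; revert H; planar; lra.
Qed.

Lemma has_angle_placed (V : nat -> pt) (f : pt -> pt) (i : nat) (q : pt) :
  convex_pentagon V -> isometry f -> (i < 5)%nat -> f (V i) = q ->
  has_angle (tile V f) q (corner_angle V i).
Proof.
  intros HV hf hi <-; rewrite <- (isometry_corner_angle V f i hf).
  apply (has_angle_vertex (fun j => f (V j))); [now apply isometry_convex|assumption].
Qed.

(** [N] lists the corners at [q], with one presentation per tile. The last hypothesis says that
    every other tile through [q] has some presentation without a vertex at [q]; that is enough,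
    because the angle depends on the tile as a set. *)
Lemma node_sum (V : nat -> pt) (T : (pt -> Prop) -> Prop) (q : pt) (N : list ((pt -> pt) * nat)) :
  convex_pentagon V -> monohedral_tiling_by (pent_region V) T ->
  (forall i j k, (i < 5)%nat -> (j < 5)%nat -> (k < 5)%nat -> corner_angle V i + corner_angle V j + corner_angle V k <> 2 * PI) ->
  (forall p, In p N -> placed V T (fst p) /\ (snd p < 5)%nat /\ fst p (V (snd p)) = q) ->
  ForallOrdPairs (fun p p' => tile V (fst p) <> tile V (fst p')) N ->
  (forall h, placed V T h -> tile V h q ->
     (exists p, In p N /\ tile V h = tile V (fst p)) \/
     (exists g, isometry g /\ tile V h = tile V g /\ forall i, (i < 5)%nat -> g (V i) <> q)) ->
  lsum (fun p => corner_angle V (snd p) - PI / 2) N <= 0.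
Proof.
  intros HV HM H3 HN FO HC; assert (HT := proj1 HM); pose proof PI_RGT_0 as Hpi.
  destruct (classic (N = [])) as [->|NE]; [simpl; lra|].
  set (items := map (fun p => (tile V (fst p), corner_angle V (snd p))) N).
  assert (Sum : forall l : list ((pt -> pt) * nat), lsum (fun p => corner_angle V (snd p) - PI / 2) l =
     lsum (fun p => corner_angle V (snd p)) l - INR (length l) * (PI / 2)).
  { induction l as [|p l IH]; [simpl; ring|].
    change (length (p :: l)) with (S (length l)); rewrite S_INR; simpl; rewrite IH; ring. }
  assert (ES : lsum snd items = lsum (fun p => corner_angle V (snd p)) N) by (unfold items; now rewrite lsum_map).
  assert (Pos : forall p, In p N -> 0 < corner_angle V (snd p) < PI).
  { intros p hp; apply corner_angle_bounds; [assumption|apply (HN p hp)]. }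
  assert (S0 : 0 < lsum snd items).
  { rewrite ES; destruct N as [|p N]; [congruence|simpl].
    pose proof (Pos p (or_introl eq_refl)).
    assert (0 <= lsum (fun p => corner_angle V (snd p)) N); [|lra].
    apply lsum_nonneg; intros p' hp'; left; apply Pos; now right. }
  assert (HI : forall p, In p items -> T (fst p) /\ has_angle (fst p) q (snd p)).
  { intros p hp; apply in_map_iff in hp; destruct hp as [p' [<- hp']].
    destruct (HN p' hp') as [[h1 h2] [h3 h4]]; split; [assumption|].
    now apply has_angle_placed. }
  assert (FI : ForallOrdPairs (fun p p' => fst p <> fst p') items).
  { unfold items; clear - FO; induction FO as [|p l Hp _ IH]; simpl; constructor; [|assumption].
    rewrite Forall_forall in *; intros p' hp'; apply in_map_iff in hp'.
    destruct hp' as [p'' [<- hp'']]; now apply Hp. }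
  assert (LI : forall p, In p items -> snd p < PI).
  { intros p hp; apply in_map_iff in hp; destruct hp as [p' [<- hp']]; apply Pos, hp'. }
  (* A tile without a corner at [q] has angle pi or 2 pi there, so by uniqueness of angles it is not
     among the listed tiles, whose angles are below pi. *)
  assert (NonV : forall h : pt -> pt, placed V T h -> tile V h q ->
     (exists g, isometry g /\ tile V h = tile V g /\ forall i, (i < 5)%nat -> g (V i) <> q) ->
     exists m, (m = PI \/ m = 2 * PI) /\ has_angle (tile V h) q m /\
       List.Forall (fun p : (pt -> Prop) * R => tile V h <> fst p) items).
  { intros h Ph hq [g [hg [Eg Vg]]].
    assert (A : exists m, (m = PI \/ m = 2 * PI) /\ has_angle (tile V h) q m).
    { rewrite Eg in *.
      destruct (has_angle_nonvertex (fun i => g (V i)) q) as [A|A];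
        [now apply isometry_convex|assumption|assumption| |];
        [exists PI|exists (2 * PI)]; (split; [tauto|assumption]). }
    destruct A as [m [hm A]]; exists m; repeat split; [assumption|apply A|apply A|].
    rewrite Forall_forall; intros p hp E.
    destruct (HI p hp) as [_ Ap]; rewrite <- E in Ap.
    pose proof (has_angle_unique _ _ _ _ A Ap); pose proof (LI p hp); lra. }
  rewrite Sum, <- ES.
  destruct (classic (exists h, placed V T h /\ tile V h q /\
     exists g, isometry g /\ tile V h = tile V g /\ forall i, (i < 5)%nat -> g (V i) <> q))
    as [[h [Ph [hq Hg]]]|NX].
  - destruct (NonV h Ph hq Hg) as [m [hm [A F]]].
    assert (U : m + lsum snd items <= 2 * PI).
    { apply (angles_le T q ((tile V h, m) :: items) HT); [|now constructor].
      intros p [<-|hp]; [split; [apply Ph|assumption]|now apply HI]. }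
    assert (L : 2 * PI <= m + lsum snd items).
    { apply (angles_ge q ((tile V h, m) :: items)).
      - intros p [<-|hp]; [assumption|now apply HI].
      - intros d; destruct (tangent_cover V T q d HV HM) as [t [Tt [tq td]]].
        destruct (tiling_placed V T t HM Tt) as [h' [Ph' ->]].
        destruct (HC h' Ph' tq) as [[p [hp E]]|Hg'].
        + exists (tile V (fst p), corner_angle V (snd p)); split; [right|now rewrite <- E].
          apply (in_map (fun p => (tile V (fst p), corner_angle V (snd p)))), hp.
        + exists (tile V h, m); split; [now left|].
          (* A second tile of this kind would bring the total to at least 2 pi plus the positive
             corner angles. *)
          destruct (classic (tile V h' = tile V h)) as [E|E]; [now rewrite <- E|exfalso].
          destruct (NonV h' Ph' tq Hg') as [m' [hm' [A' F']]].
          assert (m' + (m + lsum snd items) <= 2 * PI); [|lra].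
          apply (angles_le T q ((tile V h', m') :: (tile V h, m) :: items) HT).
          * intros p [<-|[<-|hp]]; [split; [apply Ph'|assumption]|split; [apply Ph|assumption]|now apply HI].
          * repeat constructor; assumption. }
    (* The corners have positive sum, so [m] is pi and they add up to pi; a single corner is less
       than that. *)
    assert (len : (2 <= length N)%nat).
    { destruct N as [|p [|p' N]]; [congruence| |simpl; lia].
      exfalso; pose proof (Pos p (or_introl eq_refl)); simpl in *; lra. }
    apply le_INR in len; simpl in len; nra.
  - assert (L : 2 * PI <= lsum snd items).
    { apply (angles_ge q items).
      - intros p hp; now apply HI.
      - intros d; destruct (tangent_cover V T q d HV HM) as [t [Tt [tq td]]].
        destruct (tiling_placed V T t HM Tt) as [h' [Ph' ->]].
        destruct (HC h' Ph' tq) as [[p [hp E]]|Hg'].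
        + exists (tile V (fst p), corner_angle V (snd p)); split; [|now rewrite <- E].
          apply (in_map (fun p => (tile V (fst p), corner_angle V (snd p)))), hp.
        + exfalso; apply NX; exists h'; auto. }
    assert (U : lsum snd items <= 2 * PI) by (apply (angles_le T q items); assumption).
    (* One or two corners stay below 2 pi, and three are excluded by [H3]. *)
    assert (len : (4 <= length N)%nat).
    { assert (PP : forall p, In p N -> (snd p < 5)%nat) by (intros p hp; apply (HN p hp)).
      destruct N as [|p1 [|p2 [|p3 [|p4 N]]]]; [congruence| | | |simpl; lia]; exfalso.
      - pose proof (Pos p1 (or_introl eq_refl)); simpl in *; lra.
      - pose proof (Pos p1 (or_introl eq_refl)); pose proof (Pos p2 (or_intror (or_introl eq_refl)));
          simpl in *; lra.
      - apply (H3 (snd p1) (snd p2) (snd p3)); try (apply PP; simpl; tauto); simpl in *; lra. }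
    apply le_INR in len; simpl in len; nra.
Qed.

(** * Lattice orbits of tiles *)

Definition lattice (u v w : pt) : Prop :=
  exists m n : Z, w = (IZR m * fst u + IZR n * fst v, IZR m * snd u + IZR n * snd v).

Lemma lattice_zero (u v : pt) : lattice u v (0, 0).
Proof. exists 0%Z, 0%Z; f_equal; ring. Qed.

Lemma lattice_add (u v w w' : pt) : lattice u v w -> lattice u v w' -> lattice u v (padd w w').
Proof.
  intros [m [n ->]] [m' [n' ->]]; exists (m + m')%Z, (n + n')%Z.
  rewrite !plus_IZR; unfold padd; simpl; f_equal; ring.
Qed.

Lemma lattice_sub (u v w w' : pt) : lattice u v w -> lattice u v w' -> lattice u v (psub w w').
Proof.
  intros [m [n ->]] [m' [n' ->]]; exists (m - m')%Z, (n - n')%Z.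
  rewrite !minus_IZR; unfold psub; simpl; f_equal; ring.
Qed.

Lemma translate_translate (a b : pt) (t : pt -> Prop) :
  translate a (translate b t) = translate (padd a b) t.
Proof.
  apply pred_ext; intros x; unfold translate.
  replace (psub (psub x a) b) with (psub x (padd a b)); [tauto|].
  unfold psub, padd; simpl; f_equal; ring.
Qed.

Lemma translate_zero (t : pt -> Prop) : translate (0, 0) t = t.
Proof.
  apply pred_ext; intros [x y]; unfold translate, psub; simpl; rewrite !Rminus_0_r; tauto.
Qed.

Lemma translate_multiple (T : (pt -> Prop) -> Prop) (u : pt) :
  (forall t, T t <-> T (translate u t)) ->
  forall (k : Z) t, T (translate (IZR k * fst u, IZR k * snd u) t) <-> T t.
Proof.
  intros H.
  assert (N : forall n t, T (translate (INR n * fst u, INR n * snd u) t) <-> T t).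
  { induction n as [|n IH]; intros t.
    - simpl; rewrite !Rmult_0_l, translate_zero; tauto.
    - rewrite S_INR, <- (IH t), (H (translate (INR n * fst u, _) t)), translate_translate.
      replace (padd u (INR n * fst u, INR n * snd u)) with
        ((INR n + 1) * fst u, (INR n + 1) * snd u); [tauto|].
      unfold padd; simpl; f_equal; ring. }
  intros k t; destruct (Z_le_gt_dec 0 k) as [hk|hk].
  - rewrite <- (Z2Nat.id k), <- INR_IZR_INZ by lia; apply N.
  - rewrite <- (N (Z.to_nat (- k)) (translate _ t)), translate_translate.
    rewrite INR_IZR_INZ, Z2Nat.id, opp_IZR by lia.
    replace (padd _ _) with ((0, 0) : pt); [rewrite translate_zero; tauto|].
    unfold padd; simpl; f_equal; ring.
Qed.

Lemma translate_lattice (T : (pt -> Prop) -> Prop) (u v w : pt) (t : pt -> Prop) :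
  (forall t, T t <-> T (translate u t)) -> (forall t, T t <-> T (translate v t)) ->
  lattice u v w -> T t -> T (translate w t).
Proof.
  intros Hu Hv [m [n ->]] Ht.
  apply (translate_multiple T v Hv n) in Ht; apply (translate_multiple T u Hu m) in Ht.
  rewrite translate_translate in Ht; exact Ht.
Qed.

(** Cramer's rule gives the coordinates [s], [t] of [p] in the basis [u], [v]; subtracting integer
    parts moves [p] into the fundamental parallelogram. *)
Lemma lattice_reduce (u v p : pt) : cross u v <> 0 -> exists w, lattice u v w /\
  Rabs (fst (padd p w)) <= Rabs (fst u) + Rabs (fst v) /\
  Rabs (snd (padd p w)) <= Rabs (snd u) + Rabs (snd v).
Proof.
  intros H; set (s := cross p v / cross u v); set (t := cross u p / cross u v).
  destruct (base_Int_part s) as [s1 s2]; destruct (base_Int_part t) as [t1 t2].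
  exists (IZR (- Int_part s) * fst u + IZR (- Int_part t) * fst v,
          IZR (- Int_part s) * snd u + IZR (- Int_part t) * snd v); split.
  { exists (- Int_part s)%Z, (- Int_part t)%Z; reflexivity. }
  rewrite !opp_IZR.
  assert (E1 : fst p = s * fst u + t * fst v).
  { unfold s, t; unfold cross in *; field; assumption. }
  assert (E2 : snd p = s * snd u + t * snd v).
  { unfold s, t; unfold cross in *; field; assumption. }
  assert (B : forall a b x y, 0 <= a <= 1 -> 0 <= b <= 1 -> Rabs (a * x + b * y) <= Rabs x + Rabs y).
  { intros a b x y ha hb; eapply Rle_trans; [apply Rabs_triang|].
    rewrite !Rabs_mult, (Rabs_right a), (Rabs_right b) by lra.
    pose proof (Rabs_pos x); pose proof (Rabs_pos y); nra. }
  unfold padd; simpl; rewrite E1, E2; split.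
  - replace (_ + _) with ((s - IZR (Int_part s)) * fst u + (t - IZR (Int_part t)) * fst v) by ring.
    apply B; lra.
  - replace (_ + _) with ((s - IZR (Int_part s)) * snd u + (t - IZR (Int_part t)) * snd v) by ring.
    apply B; lra.
Qed.

Lemma vertices_distinct (W : nat -> pt) (i j : nat) : convex_pentagon W ->
  (i < 5)%nat -> (j < 5)%nat -> i <> j -> W i <> W j.
Proof.
  intros HW hi hj n E; destruct (nxt_neq i hi) as [n1 [n2 [n3 _]]].
  destruct (Nat.eq_dec j (nxt i)) as [->|n'].
  - pose proof (edge_form_vertex_pos W i (nxt (nxt i)) HW hi (nxt_lt _) n2 n3) as K.
    unfold edge_form in K; rewrite <- E in K; revert K; planar; lra.
  - pose proof (edge_form_vertex_pos W i j HW hi hj ltac:(auto) n') as K.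
    rewrite <- E, edge_form_vertex_self in K; lra.
Qed.

Lemma multiples_bounded (a b : R) : (forall n, 0 <= a + INR n * b) -> 0 <= b.
Proof.
  intros H; destruct (Rle_dec 0 b) as [h|h]; [assumption|exfalso].
  assert (ha : 0 <= a) by (specialize (H 0%nat); simpl in H; lra).
  destruct (INR_unbounded (a / - b)) as [n hn].
  specialize (H n).
  assert (a / - b * - b < INR n * - b) by (apply Rmult_lt_compat_r; lra).
  replace (a / - b * - b) with a in * by (field; lra); lra.
Qed.

(** An invariant region contains [W 0 + n w] for all integers [n]. An edge form is affine in [n] and
    nonnegative, so its slope along [w] vanishes; thus [w] is parallel to two nonparallel edges. *)
Lemma region_no_period (W : nat -> pt) (w : pt) : convex_pentagon W ->
  pent_region W = translate w (pent_region W) -> w = (0, 0).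
Proof.
  intros HW E.
  assert (H0 : pent_region W (W 0%nat)).
  { intros j hj; change (0 <= edge_form W j (W 0%nat)).
    destruct (Nat.eq_dec 0 j) as [<-|h1]; [rewrite edge_form_vertex_self; lra|].
    destruct (Nat.eq_dec 0 (nxt j)) as [h2|h2]; [rewrite h2, edge_form_vertex_nxt; lra|].
    left; apply edge_form_vertex_pos; auto; lia. }
  assert (St : forall x, pent_region W x <-> pent_region W (psub x w)).
  { intros x; change (pent_region W x <-> translate w (pent_region W) x); rewrite <- E; tauto. }
  assert (Up : forall n, pent_region W (pmove (W 0%nat) (INR n) w)).
  { induction n as [|n IH].
    - unfold pmove; simpl; rewrite !Rmult_0_l, !Rplus_0_r, <- surjective_pairing; assumption.
    - rewrite S_INR, St; replace (psub _ w) with (pmove (W 0%nat) (INR n) w); [assumption|].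
      unfold pmove, psub; simpl; f_equal; ring. }
  assert (Dn : forall n, pent_region W (pmove (W 0%nat) (- INR n) w)).
  { induction n as [|n IH].
    - unfold pmove; simpl; rewrite Ropp_0, !Rmult_0_l, !Rplus_0_r, <- surjective_pairing; assumption.
    - rewrite St in IH; rewrite S_INR.
      replace (pmove (W 0%nat) (- (INR n + 1)) w) with (psub (pmove (W 0%nat) (- INR n) w) w); [assumption|].
      unfold pmove, psub; simpl; f_equal; ring. }
  assert (Z : forall j, (j < 5)%nat -> edge_slope W j w = 0).
  { intros j hj.
    assert (0 <= edge_slope W j w).
    { apply (multiples_bounded (edge_form W j (W 0%nat))); intros n; rewrite <- edge_form_pmove; apply Up, hj. }
    assert (0 <= - edge_slope W j w); [|lra].
    apply (multiples_bounded (edge_form W j (W 0%nat))); intros n.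
    replace (INR n * - edge_slope W j w) with (- INR n * edge_slope W j w) by ring.
    rewrite <- edge_form_pmove; apply Dn, hj. }
  assert (ZC : forall j, (j < 5)%nat -> cross (psub (W (nxt j)) (W j)) w = 0).
  { intros j hj; specialize (Z j hj); unfold edge_slope in Z; apply Rmult_integral in Z.
    destruct Z as [|Z]; [assumption|exfalso].
    destruct (nxt_neq j hj) as [n1 [n2 [n3 _]]].
    destruct HW as [H|H]; specialize (H j (nxt (nxt j)) hj (nxt_lt _) n2 n3); lra. }
  pose proof (ZC 0%nat ltac:(lia)) as Z0; pose proof (ZC 1%nat ltac:(lia)) as Z1.
  unfold nxt in Z0, Z1; simpl in Z0, Z1.
  set (a := psub (W 1%nat) (W 0%nat)) in *; set (b := psub (W 2%nat) (W 1%nat)) in *.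
  assert (K : cross a b <> 0).
  { replace (cross a b) with (cross a (psub (W 2%nat) (W 0%nat))) by (unfold a, b; planar; ring).
    destruct HW as [H|H];
    specialize (H 0%nat 2%nat ltac:(lia) ltac:(lia) ltac:(lia) ltac:(unfold nxt; simpl; lia));
    unfold nxt in H; simpl in H; fold a in H; lra. }
  assert (W1 : fst w * cross a b = 0).
  { transitivity (cross a w * fst b - cross b w * fst a); [unfold cross; ring|].
    rewrite Z0, Z1; ring. }
  assert (W2 : snd w * cross a b = 0).
  { transitivity (cross a w * snd b - cross b w * snd a); [unfold cross; ring|].
    rewrite Z0, Z1; ring. }
  apply Rmult_integral in W1; apply Rmult_integral in W2.
  destruct w as [w1 w2]; simpl in *; f_equal; tauto.
Qed.

Lemma prune {A : Type} (E : A -> A -> Prop) (L : list A) :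
  (forall a, E a a) -> (forall a b, E a b -> E b a) ->
  exists R, NoDup R /\ (forall a, In a R -> In a L) /\
    (forall a b, In a R -> In b R -> E a b -> a = b) /\
    (forall a, In a L -> exists b, In b R /\ E a b).
Proof.
  intros Hr Hs; induction L as [|x L [R [R1 [R2 [R3 R4]]]]].
  - exists []; repeat split; simpl; try tauto; constructor.
  - destruct (classic (exists b, In b R /\ E x b)) as [[b [ib eb]]|N].
    + exists R; repeat split; auto; [intros a ha; right; auto|].
      intros a [<-|ha]; [exists b; auto|auto].
    + exists (x :: R); repeat split.
      * constructor; [|assumption]; intros h; apply N; exists x; auto.
      * intros a [<-|ha]; [now left|right; auto].
      * intros a b [<-|ha] [<-|hb] e; auto; exfalso; apply N; eauto.
      * intros a [<-|ha]; [exists x; split; [now left|auto]|].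
        destruct (R4 a ha) as [b [hb eb]]; exists b; split; [now right|assumption].
Qed.

(** Each tile has a translate with centre in a bounded box, where only finitely many tiles occur;
    [prune] then keeps one per orbit. *)
Lemma tile_orbits (V : nat -> pt) (T : (pt -> Prop) -> Prop) (u v : pt) :
  convex_pentagon V -> monohedral_tiling_by (pent_region V) T -> cross u v <> 0 ->
  (forall t, T t <-> T (translate u t)) -> (forall t, T t <-> T (translate v t)) ->
  exists R, NoDup R /\ (forall f, In f R -> placed V T f) /\
    (forall f g w, In f R -> In g R -> lattice u v w -> tile V f = translate w (tile V g) -> f = g) /\
    (forall h, placed V T h -> exists f w, In f R /\ lattice u v w /\ tile V h = translate w (tile V f)).
Proof.
  intros HV HM Hc Hu Hv.
  destruct (region_interior_nonempty V HV) as [c Hin].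
  set (M := Rabs (fst u) + Rabs (fst v) + (Rabs (snd u) + Rabs (snd v))).
  destruct (finitely_many_tiles V T c M (proj1 HM) Hin) as [L [L1 L2]].
  set (E := fun f g => exists w, lattice u v w /\ tile V f = translate w (tile V g)).
  destruct (prune E L) as [R [R1 [R2 [R3 R4]]]].
  - intros f; exists (0, 0); split; [apply lattice_zero|now rewrite translate_zero].
  - intros f g [w [hw e]]; exists (psub (0, 0) w); split.
    + apply lattice_sub; [apply lattice_zero|assumption].
    + rewrite e, translate_translate; replace (padd _ w) with ((0, 0) : pt);
        [now rewrite translate_zero|unfold padd, psub; simpl; f_equal; ring].
  - exists R; split; [assumption|]; split; [auto|]; split.
    + intros f g w hf hg hw e; apply R3; auto; exists w; auto.
    + intros h Ph.
      destruct (lattice_reduce u v (h c) Hc) as [w [hw [b1 b2]]].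
      destruct (L2 (fun x => padd (h x) w)) as [g [hg eg]].
      * split; [apply isometry_padd, Ph|]; rewrite <- translate_tile.
        apply translate_lattice with u v; auto; apply Ph.
      * pose proof (Rabs_pos (snd u)); pose proof (Rabs_pos (snd v)); unfold M; lra.
      * pose proof (Rabs_pos (fst u)); pose proof (Rabs_pos (fst v)); unfold M; lra.
      * destruct (R4 g hg) as [f [hf [w' [hw' ef]]]].
        exists f, (psub w' w); split; [assumption|]; split; [now apply lattice_sub|].
        rewrite <- translate_tile, ef in eg.
        (* Undo the translation by [w] that brought the centre of [h] into the box. *)
        assert (EE : translate (psub (0, 0) w) (translate w (tile V h)) =
                     translate (psub (0, 0) w) (translate w' (tile V f))) by now rewrite eg.
        rewrite !translate_translate in EE.
        replace (padd (psub (0, 0) w) w) with ((0, 0) : pt) in EE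
          by (unfold padd, psub; simpl; f_equal; ring).
        rewrite translate_zero in EE; rewrite EE; f_equal.
        unfold padd, psub; simpl; f_equal; ring.
Qed.

(** * Double counting *)

(* Congruent points have equal predicates here, hence the same [epsilon]. *)
Definition lattice_rep (u v p : pt) : pt :=
  epsilon (inhabits ((0, 0) : pt)) (fun q => lattice u v (psub q p)).

Lemma lattice_rep_spec (u v p : pt) : lattice u v (psub (lattice_rep u v p) p).
Proof.
  unfold lattice_rep; apply (epsilon_spec (inhabits ((0, 0) : pt)) (fun q => lattice u v (psub q p))).
  exists p; replace (psub p p) with ((0, 0) : pt); [apply lattice_zero|].
  unfold psub; f_equal; ring.
Qed.

Lemma lattice_rep_eq (u v p p' : pt) : lattice u v (psub p p') -> lattice_rep u v p = lattice_rep u v p'.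
Proof.
  intros H; unfold lattice_rep; f_equal; apply pred_ext; intros q; split; intros K.
  - replace (psub q p') with (padd (psub q p) (psub p p'));
      [now apply lattice_add|unfold padd, psub; simpl; f_equal; ring].
  - replace (psub q p) with (psub (psub q p') (psub p p'));
      [now apply lattice_sub|unfold psub; simpl; f_equal; ring].
Qed.

Definition eqb_pt (p q : pt) : bool := if excluded_middle_informative (p = q) then true else false.

Lemma eqb_pt_true (p q : pt) : eqb_pt p q = true <-> p = q.
Proof. unfold eqb_pt; destruct excluded_middle_informative; split; congruence. Qed.

Lemma lsum_filter {A : Type} (h : A -> R) (b : A -> bool) (l : list A) :
  lsum h l = lsum h (filter b l) + lsum h (filter (fun a => negb (b a)) l).
Proof.
  induction l as [|a l IH]; simpl; [ring|].
  rewrite IH; destruct (b a); simpl; ring.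
Qed.

(** Split off the whole fibre of the head and recurse on the rest: there that fibre is empty and the
    other fibres are unchanged. *)
Lemma lsum_fibers {A : Type} (h : A -> R) (loc : A -> pt) (l : list A) :
  (forall q, lsum h (filter (fun a => eqb_pt (loc a) q) l) <= 0) -> lsum h l <= 0.
Proof.
  remember (length l) as n eqn:En; assert (Hn : (length l <= n)%nat) by lia; clear En.
  revert l Hn; induction n as [|n IH]; intros l Hn H.
  - destruct l; [simpl; lra|simpl in Hn; lia].
  - destruct l as [|a l]; [simpl; lra|].
    rewrite (lsum_filter h (fun x => eqb_pt (loc x) (loc a))).
    assert (lsum h (filter (fun x => negb (eqb_pt (loc x) (loc a))) (a :: l)) <= 0);
      [|specialize (H (loc a)); lra].
    assert (Ea : eqb_pt (loc a) (loc a) = true) by now apply eqb_pt_true.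
    apply IH.
    + simpl; rewrite Ea; simpl.
      pose proof (filter_length_le (fun x => negb (eqb_pt (loc x) (loc a))) l).
      simpl in Hn; lia.
    + intros q; destruct (classic (q = loc a)) as [->|nq].
      * match goal with |- lsum h ?f <= 0 => replace f with (@nil A) end; [simpl; lra|].
        generalize (a :: l); induction l0 as [|x l0 IHl]; simpl; [reflexivity|].
        destruct (eqb_pt (loc x) (loc a)) eqn:e; simpl; [|rewrite e]; assumption.
      * replace (filter _ (filter _ (a :: l))) with (filter (fun x => eqb_pt (loc x) q) (a :: l));
          [apply H|].
        generalize (a :: l); induction l0 as [|x l0 IHl]; simpl; [reflexivity|].
        destruct (eqb_pt (loc x) q) eqn:e1, (eqb_pt (loc x) (loc a)) eqn:e2; simpl;
          rewrite ?e1, <- ?IHl; try reflexivity.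
        apply eqb_pt_true in e1, e2; congruence.
Qed.

Lemma ForallOrdPairs_map_NoDup {A B : Type} (F : A -> B) (Rel : B -> B -> Prop) (l : list A) :
  NoDup l -> (forall a b, In a l -> In b l -> a <> b -> Rel (F a) (F b)) ->
  ForallOrdPairs Rel (map F l).
Proof.
  induction 1 as [|a l na _ IH]; intros H; simpl; constructor.
  - rewrite Forall_forall; intros y hy; apply in_map_iff in hy; destruct hy as [b [<- hb]].
    apply H; [now left|now right|congruence].
  - apply IH; intros x y hx hy; apply H; now right.
Qed.

Lemma NoDup_list_prod {A B : Type} (l : list A) (l' : list B) :
  NoDup l -> NoDup l' -> NoDup (list_prod l l').
Proof.
  intros H H'; induction H as [|a l na _ IH]; simpl; [constructor|].
  apply NoDup_app; [apply NoDup_map_NoDup_ForallPairs|assumption|].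
  - intros x y _ _ e; congruence.
  - assumption.
  - intros [x y] h1 h2; apply in_map_iff in h1; destruct h1 as [y' [e _]].
    apply in_prod_iff in h2; injection e as -> _; tauto.
Qed.

(** * The contradiction and the passage to degrees *)

Lemma no_three_angles_absurd (V : nat -> pt) (T : (pt -> Prop) -> Prop) :
  convex_pentagon V -> monohedral_tiling_by (pent_region V) T -> periodic T ->
  ~ (forall i j k, (i < 5)%nat -> (j < 5)%nat -> (k < 5)%nat ->
       corner_angle V i + corner_angle V j + corner_angle V k <> 2 * PI).
Proof.
  intros HV HM [u [v [Hc [Hu Hv]]]] H3; pose proof PI_RGT_0 as Hpi.
  destruct (tile_orbits V T u v HV HM Hc Hu Hv) as [R [R1 [R2 [R3 R4]]]].
  set (h := fun p : (pt -> pt) * nat => corner_angle V (snd p) - PI / 2).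
  set (J := list_prod R (seq 0 5)).
  assert (NE : R <> []).
  { destruct (proj1 (proj2 (proj1 HM)) (0, 0)) as [t [Tt _]].
    destruct (tiling_placed V T t HM Tt) as [f [Pf _]].
    destruct (R4 f Pf) as [g [_ [hg _]]]; intros ->; exact hg. }
  assert (Pos : 0 < lsum h J).
  { assert (E : forall l, lsum h (list_prod l (seq 0 5)) = INR (length l) * (PI / 2)).
    { induction l as [|f l IH]; [simpl; ring|].
      change (list_prod (f :: l) (seq 0 5)) with (map (pair f) (seq 0 5) ++ list_prod l (seq 0 5)).
      change (length (f :: l)) with (S (length l)).
      rewrite lsum_app, IH, S_INR; unfold h; simpl.
      pose proof (pentagon_sum V HV); lra. }
    unfold J; rewrite E; apply Rmult_lt_0_compat; [|lra].
    apply lt_0_INR; destruct R; [congruence|simpl; lia]. }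
  assert (Neg : lsum h J <= 0); [|lra].
  apply lsum_fibers with (fun p => lattice_rep u v (fst p (V (snd p)))); intros q.
  set (Jq := filter _ J).
  assert (InJ : forall p, In p Jq <-> In (fst p) R /\ (snd p < 5)%nat /\ lattice_rep u v (fst p (V (snd p))) = q).
  { intros [f i]; unfold Jq, J; rewrite filter_In, in_prod_iff, in_seq, eqb_pt_true; simpl.
    split; intros; repeat split; try tauto; lia. }
  destruct (classic (Jq = [])) as [->|NJ]; [simpl; lra|].
  (* An arbitrary [q] need not be its own representative; it is one here because some corner in [Jq]
     has representative [q]. *)
  assert (Rq : forall p, lattice u v (psub q p) -> lattice_rep u v p = q).
  { assert (Q : lattice_rep u v q = q).
    { destruct Jq as [|p l]; [congruence|].
      destruct (proj1 (InJ p) (or_introl eq_refl)) as [_ [_ <-]].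
      apply lattice_rep_eq, lattice_rep_spec. }
    intros p hp; rewrite <- Q; symmetry; now apply lattice_rep_eq. }
  (* Moves the corner [p] of an orbit representative to [q] by a period. The images are the corners
     at [q] required by [node_sum]. *)
  set (F := fun p : (pt -> pt) * nat =>
    ((fun x => padd (fst p x) (psub q (fst p (V (snd p))))), snd p)).
  assert (lat : forall p, In p Jq -> lattice u v (psub q (fst p (V (snd p))))).
  { intros p hp; apply InJ in hp; destruct hp as [_ [_ <-]]; apply lattice_rep_spec. }
  assert (EF : forall p, tile V (fst (F p)) = translate (psub q (fst p (V (snd p)))) (tile V (fst p))).
  { intros p; symmetry; apply translate_tile. }
  transitivity (lsum h (map F Jq)); [rewrite lsum_map; right; reflexivity|].
  apply (node_sum V T q); try assumption.
  - intros p hp; apply in_map_iff in hp; destruct hp as [p' [<- hp]].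
    assert (L := lat p' hp); apply InJ in hp; destruct hp as [h1 [h2 h3]].
    destruct (R2 _ h1) as [i1 t1]; split; [split|split].
    + now apply isometry_padd.
    + rewrite EF; now apply translate_lattice with u v.
    + exact h2.
    + simpl; destruct q; unfold padd, psub; simpl; f_equal; ring.
  - apply ForallOrdPairs_map_NoDup.
    { apply NoDup_filter, NoDup_list_prod; [assumption|apply seq_NoDup]. }
    (* If two moved tiles coincide, they come from one representative, as [R] meets each orbit once;
       the two shifts then agree by [region_no_period], hence so do the corners. *)
    intros p p' hp hp' np E; rewrite !EF in E.
    assert (L := lat p hp); assert (L' := lat p' hp').
    apply InJ in hp; apply InJ in hp'.
    set (w := psub q (fst p (V (snd p)))) in *; set (w' := psub q (fst p' (V (snd p')))) in *.
    assert (E2 : translate (psub (0, 0) w) (translate w (tile V (fst p))) =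
                 translate (psub (0, 0) w) (translate w' (tile V (fst p')))) by now rewrite E.
    rewrite !translate_translate in E2.
    replace (padd (psub (0, 0) w) w) with ((0, 0) : pt) in E2
      by (unfold padd, psub; simpl; f_equal; ring).
    replace (padd (psub (0, 0) w) w') with (psub w' w) in E2
      by (unfold padd, psub; simpl; f_equal; ring).
    rewrite translate_zero in E2.
    assert (Ef : fst p = fst p').
    { apply R3 with (psub w' w); [tauto|tauto|now apply lattice_sub|assumption]. }
    assert (HW : convex_pentagon (fun i => fst p (V i))).
    { apply isometry_convex; [apply R2; tauto|assumption]. }
    rewrite <- Ef in E2; apply region_no_period in E2; [|assumption].
    apply (vertices_distinct _ (snd p) (snd p') HW); [tauto|tauto| |].
    + intros e; apply np; destruct p, p'; simpl in *; congruence.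
    + simpl; unfold w, w' in E2; rewrite <- Ef in E2; unfold psub in E2; simpl in E2.
      injection E2 as e1 e2.
      rewrite (surjective_pairing (fst p (V (snd p)))), (surjective_pairing (fst p (V (snd p')))).
      f_equal; lra.
  - intros g Pg gq.
    destruct (R4 g Pg) as [f [w [hf [hw e]]]].
    rewrite translate_tile in e.
    (* The labelling of corners by [g] is discarded: the tile is presented as a translate of its
       representative [f], and this presentation either has a vertex at [q], hence is listed, or has
       none. *)
    destruct (classic (exists i, (i < 5)%nat /\ padd (f (V i)) w = q)) as [[i [hi ei]]|N].
    + left; exists (F (f, i)).
      assert (Ew : psub q (f (V i)) = w).
      { rewrite <- ei; destruct w; unfold psub, padd; simpl; f_equal; ring. }
      split.
      * apply in_map, InJ; simpl; repeat split; [assumption|assumption|].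
        apply Rq; rewrite Ew; assumption.
      * unfold F; simpl; rewrite Ew; assumption.
    + right; exists (fun x => padd (f x) w); split; [|split; [assumption|]].
      * apply isometry_padd, R2, hf.
      * intros i hi ei; apply N; exists i; auto.
Qed.

Theorem theorem1 (V : nat -> pt) :
  convex_pentagon V ->
  (exists T, monohedral_tiling_by (pent_region V) T /\ periodic T) ->
  exists i j k, (i < 5)%nat /\ (j < 5)%nat /\ (k < 5)%nat /\
    interior_angle V i + interior_angle V j + interior_angle V k = 360.
Proof.
  intros HV [T [HM HP]]; apply NNPP; intros N; pose proof PI_RGT_0.
  apply (no_three_angles_absurd V T HV HM HP); intros i j k hi hj hk E; apply N.
  exists i, j, k; repeat split; try assumption.
  change (corner_angle V i * 180 / PI + corner_angle V j * 180 / PI + corner_angle V k * 180 / PI = 360).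
  transitivity ((corner_angle V i + corner_angle V j + corner_angle V k) * 180 / PI); [field; lra|].
  rewrite E; field; lra.
Qed.
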